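(* Let $T$ be a complete theory of cardinality $\tau$ that is $(\mu,\tau^{+})$-almost indiscernible, where $\mu\le\tau$. Then $T$ is stable in every cardinal $\lambda\ge\tau$; hence $T$ is superstable. In particular, if $T$ is countable and $(\aleph_0,\aleph_1)$-almost indiscernible, then $T$ is totally transcendental.
   Context: Let $T$ be a complete theory of cardinality $\tau$, $\mu\le\tau$ a finite or infinite cardinal, and $\kappa>\tau$ a cardinal. $T$ is called $(\mu,\kappa)$-almost indiscernible if it has a saturated model of cardinality $\kappa$ which is in the algebraic closure of an indiscernible set of $\mu$-sequences. Algebraic closure is taken in the sense of $\mathfrak{M}^{\mathrm{eq}}$, where $\mathfrak{M}$ is a sufficiently large saturated model (universe) of $T$. A theory is totally transcendental if every formula (every type) has ordinal-valued Morley rank. *)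

(* Defs.v *)
From Stdlib Require Import RelationClasses.
From mathcomp Require Import all_boot.
From mathcomp Require Import boolp classical_sets functions cardinality.

Set Implicit Arguments.
Unset Strict Implicit.
Unset Printing Implicit Defensive.

Local Open Scope classical_set_scope.
Local Open Scope card_scope.

(** * First-order logic *)

Record language : Type := Language {
  fsym : Type;
  fsym_arity : fsym -> nat;
  rsym : Type;
  rsym_arity : rsym -> nat
}.

(* [term L V] and [formula L V] have their free variables in the type V, and
   [All] binds the variable [None].  Hence sentences are [formula L void], and
   formulas in n free variables with parameters from a set A are
   [formula L ('I_n + A)], where the variable [inr a] is interpreted by a. *)
Inductive term (L : language) (V : Type) : Type :=
| Var of V
| App (f : fsym L) of ('I_(fsym_arity f) -> term L V).

Inductive formula (L : language) (V : Type) : Type :=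
| Bot
| Eq of term L V & term L V
| Rel (r : rsym L) of ('I_(rsym_arity r) -> term L V)
| Imp of formula L V & formula L V
| All of formula L (option V).

Arguments Var {L V}.
Arguments App {L V}.
Arguments Bot {L V}.
Arguments Eq {L V}.
Arguments Rel {L V}.
Arguments Imp {L V}.
Arguments All {L V}.

Definition Neg L V (phi : formula L V) : formula L V := Imp phi Bot.

Record structure (L : language) : Type := Structure {
  carrier :> Type;
  carrier_inhabited : inhabited carrier;
  finterp : forall f : fsym L, ('I_(fsym_arity f) -> carrier) -> carrier;
  rinterp : forall r : rsym L, ('I_(rsym_arity r) -> carrier) -> Prop
}.

Fixpoint eval L (M : structure L) V (v : V -> M) (t : term L V) : M :=
  match t with
  | Var x => v x
  | App f args => finterp (fun i => eval v (args i))
  end.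

Fixpoint sat L (M : structure L) V (v : V -> M) (phi : formula L V) : Prop :=
  match phi with
  | Bot => False
  | Eq t u => eval v t = eval v u
  | Rel r args => rinterp (fun i => eval v (args i))
  | Imp psi chi => sat v psi -> sat v chi
  | All psi => forall a : M, sat (oapp v a) psi
  end.

Definition sum_val (V W M : Type) (v : V -> M) (w : W -> M) (x : V + W) : M :=
  match x with inl y => v y | inr z => w z end.

Definition theory (L : language) : Type := set (formula L void).

Definition models L (M : structure L) (T : theory L) : Prop :=
  forall phi, T phi -> sat (of_void M) phi.

(* Complete theories are taken deductively closed, that is, maximal among the
   satisfiable sets of sentences.  The cardinality of T as a set is then that
   of the set of all L-formulas: the usual |T|, which is always infinite. *)
Definition complete L (T : theory L) : Prop :=
  (exists M : structure L, models M T) /\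
  (forall phi, T phi \/ T (Neg phi)).

(** * Cardinals, represented by types *)

Definition card_lt (T U : Type) (A : set T) (B : set U) : Prop :=
  A #<= B /\ ~ (B #<= A).

Definition succ_card (Tau Kappa : Type) : Prop :=
  card_lt [set: Tau] [set: Kappa] /\
  (forall X : Type, card_lt [set: Tau] [set: X] -> [set: Kappa] #<= [set: X]).

(** * Types, saturation, stability *)

Definition sat_over L (M : structure L) (A : set M) n (b : 'I_n -> M)
    (phi : formula L ('I_n + A)) : Prop :=
  sat (sum_val b (fun a : A => val a)) phi.

(* The elements of S_n(A), for A a subset of the model M; consistency with
   Th(M, a)_(a in A) is finite satisfiability in M. *)
Definition complete_type L (M : structure L) (A : set M) n
    (p : set (formula L ('I_n + A))) : Prop :=
  (forall phi, p phi \/ p (Neg phi)) /\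
  (forall F, finite_set F -> F `<=` p ->
     exists b : 'I_n -> M, F `<=` sat_over b).

Definition type_space L (M : structure L) (A : set M) n :
    set (set (formula L ('I_n + A))) :=
  [set p | complete_type p].

Arguments type_space {L M} A n.

Definition card_saturated L (M : structure L) (Kappa : Type) : Prop :=
  forall A : set M, card_lt A [set: Kappa] ->
  forall p : set (formula L ('I_1 + A)), complete_type p ->
  exists b : 'I_1 -> M, p `<=` sat_over b.

Definition saturated L (M : structure L) : Prop := card_saturated M M.

Definition stable_in L (T : theory L) (Lambda : Type) : Prop :=
  forall M : structure L, models M T ->
  forall A : set M, A #<= [set: Lambda] ->
  forall n, type_space A n #<= [set: Lambda].

Definition superstable L (T : theory L) : Prop :=
  exists Kappa : Type, forall Lambda : Type,
    [set: Kappa] #<= [set: Lambda] -> stable_in T Lambda.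

(** * The many-sorted structure M^eq *)

Definition defines_equivalence L (M : structure L) n
    (E : formula L ('I_n + 'I_n)) : Prop :=
  Equivalence (fun a b : 'I_n -> M => sat (sum_val a b) E).

Record imag_sort L (M : structure L) : Type := ImagSort {
  imag_dim : nat;
  imag_rel : formula L ('I_imag_dim + 'I_imag_dim);
  imag_relP : defines_equivalence M imag_rel
}.

Inductive eq_sort L (M : structure L) : Type :=
| Home
| Quot of imag_sort M.

Arguments Home {L M}.

Definition imag_class L (M : structure L) (E : imag_sort M)
    (a : 'I_(imag_dim E) -> M) : set ('I_(imag_dim E) -> M) :=
  [set b | sat (sum_val a b) (imag_rel E)].

Definition eq_carrier L (M : structure L) (s : eq_sort M) : Type :=
  match s with
  | Home => M
  | Quot E => {X : set ('I_(imag_dim E) -> M) | exists a, X = imag_class a}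
  end.

Definition imag_proj L (M : structure L) (E : imag_sort M)
    (a : 'I_(imag_dim E) -> M) : eq_carrier (Quot E) :=
  exist _ (imag_class a) (ex_intro _ a erefl).

(* Terms and formulas of the many-sorted language L^eq: the symbols of L on the
   home sort, and for every sort E the projection from home tuples onto it.
   A context V gives, for each sort, the type of free variables of that sort. *)
Inductive eq_term L (M : structure L) (V : eq_sort M -> Type) :
    eq_sort M -> Type :=
| EqVar s of V s : eq_term V s
| EqApp (f : fsym L) of ('I_(fsym_arity f) -> eq_term V Home) : eq_term V Home
| EqProj (E : imag_sort M) of ('I_(imag_dim E) -> eq_term V Home) :
    eq_term V (Quot E).

Inductive eq_ctx_ext L (M : structure L) (V : eq_sort M -> Type)
    (s : eq_sort M) : eq_sort M -> Type :=
| NewVar : eq_ctx_ext V s s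
| OldVar s' of V s' : eq_ctx_ext V s s'.

Inductive eq_formula L (M : structure L) (V : eq_sort M -> Type) : Type :=
| EqBot
| EqEq s of eq_term V s & eq_term V s
| EqRel (r : rsym L) of ('I_(rsym_arity r) -> eq_term V Home)
| EqImp of eq_formula V & eq_formula V
| EqAll s of eq_formula (eq_ctx_ext V s).

Definition eq_valuation L (M : structure L) (V : eq_sort M -> Type) : Type :=
  forall s, V s -> eq_carrier s.

Definition eq_val_ext L (M : structure L) (V : eq_sort M -> Type)
    (v : eq_valuation V) s (a : eq_carrier s) :
    eq_valuation (eq_ctx_ext V s) :=
  fun s' x =>
    match x in eq_ctx_ext _ _ s' return eq_carrier s' with
    | NewVar => a
    | OldVar _ y => v _ y
    end.

Fixpoint eq_eval L (M : structure L) (V : eq_sort M -> Type)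
    (v : eq_valuation V) s (t : eq_term V s) : eq_carrier s :=
  match t in eq_term _ s return eq_carrier s with
  | EqVar _ x => v _ x
  | EqApp f args => finterp (s := M) (fun i => eq_eval v (args i))
  | EqProj E args => imag_proj (fun i => eq_eval v (args i))
  end.

Fixpoint eq_sat L (M : structure L) (V : eq_sort M -> Type)
    (v : eq_valuation V) (phi : eq_formula V) : Prop :=
  match phi with
  | EqBot => False
  | EqEq _ t u => eq_eval v t = eq_eval v u
  | EqRel r args => rinterp (s := M) (fun i => eq_eval v (args i))
  | EqImp psi chi => eq_sat v psi -> eq_sat v chi
  | EqAll s psi => forall a : eq_carrier s, eq_sat (eq_val_ext v a) psi
  end.

(* Algebraic closure in M^eq of a set A of elements of M^eq. *)
Definition acl_eq L (M : structure L) (A : forall s : eq_sort M, set (eq_carrier s))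
    (s : eq_sort M) : set (eq_carrier s) :=
  [set b | exists phi : eq_formula (eq_ctx_ext (fun s' => A s') s),
     let solutions :=
       [set x | eq_sat (eq_val_ext (fun s' (a : A s') => val a) x) phi] in
     solutions b /\ finite_set solutions].

(** * Indiscernible sets of sequences and almost indiscernible theories *)

(* Mu-sequences in M^eq whose i-th entry has sort [sigma i]; any two members of
   an indiscernible set of sequences have the same sorts. *)
Definition eq_seq L (M : structure L) (Mu : Type) (sigma : Mu -> eq_sort M) :
    Type :=
  forall i : Mu, eq_carrier (sigma i).

(* The context of a concatenation of n sequences of sorts sigma. *)
Inductive seq_ctx L (M : structure L) (Mu : Type) (sigma : Mu -> eq_sort M)
    (n : nat) : eq_sort M -> Type :=
| SeqVar (j : 'I_n) (i : Mu) : seq_ctx sigma n (sigma i).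

Definition seq_val L (M : structure L) (Mu : Type) (sigma : Mu -> eq_sort M)
    n (e : 'I_n -> eq_seq sigma) : eq_valuation (seq_ctx sigma n) :=
  fun s x =>
    match x in seq_ctx _ _ s return eq_carrier s with
    | SeqVar j i => e j i
    end.

Definition indiscernible_set L (M : structure L) (Mu : Type)
    (sigma : Mu -> eq_sort M) (I : set (eq_seq sigma)) : Prop :=
  forall n (e f : 'I_n -> eq_seq sigma),
    injective e -> injective f -> (forall j, I (e j)) -> (forall j, I (f j)) ->
  forall phi : eq_formula (seq_ctx sigma n),
    eq_sat (seq_val e) phi <-> eq_sat (seq_val f) phi.

Inductive seq_entries L (M : structure L) (Mu : Type)
    (sigma : Mu -> eq_sort M) (I : set (eq_seq sigma)) :
    forall s : eq_sort M, set (eq_carrier s) :=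
| SeqEntry (e : eq_seq sigma) (i : Mu) of I e : seq_entries I (e i).

Definition almost_indiscernible L (T : theory L) (Mu Kappa : Type) : Prop :=
  exists M : structure L,
    [/\ models M T, saturated M, [set: M] #= [set: Kappa] &
      exists (sigma : Mu -> eq_sort M) (I : set (eq_seq sigma)),
        indiscernible_set I /\
        forall b : M, acl_eq (seq_entries I) (s := Home) b].

(** * Morley rank and total transcendence *)

(* Notations for ordinals: [OSup f] denotes the supremum of the ordinals f i.
   Every ordinal is denoted, as small families of any size are allowed. *)
Inductive ordinal_tree : Type :=
| OZero
| OSucc of ordinal_tree
| OSup (I : Type) of (I -> ordinal_tree).

Definition def_set L (M : structure L) n (phi : formula L ('I_n + M)) :
    set ('I_n -> M) :=
  [set b | sat (sum_val b id) phi].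

(* RM(phi) >= alpha, computed in M; this is the Morley rank of phi when M is
   aleph_0-saturated. *)
Fixpoint morley_rank_ge L (M : structure L) n (alpha : ordinal_tree)
    (phi : formula L ('I_n + M)) {struct alpha} : Prop :=
  match alpha with
  | OZero => def_set phi !=set0
  | OSucc beta =>
      exists psi : nat -> formula L ('I_n + M),
        [/\ forall k, def_set (psi k) `<=` def_set phi,
            trivIset [set: nat] (fun k => def_set (psi k)) &
            forall k, morley_rank_ge beta (psi k)]
  | OSup _ f => def_set phi !=set0 /\ forall i, morley_rank_ge (f i) phi
  end.

(* No formula has Morley rank infinity; inconsistent formulas fail rank >= 0. *)
Definition totally_transcendental L (T : theory L) : Prop :=
  forall M : structure L, models M T -> card_saturated M nat ->
  forall n (phi : formula L ('I_n + M)),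
  exists alpha : ordinal_tree, ~ morley_rank_ge alpha phi.

(* Main.v *)
Require Import Defs.
From mathcomp Require Import all_boot.
From mathcomp Require Import boolp classical_sets functions cardinality filter.
From Stdlib Require List.
From Stdlib Require Import Eqdep.

Set Implicit Arguments.
Unset Strict Implicit.
Unset Printing Implicit Defensive.

Local Open Scope classical_set_scope.
Local Open Scope card_scope.

(** Let [M] be the given saturated model, of size greater than [Tau], and let
    [X] be the indiscernible set of sequences over which all of [M] is algebraic.
    There are only [Tau]-many formulas, so [X] has more than [Tau] elements.

    Stability in [Lambda] means that there are few types over a set [A] with at
    most [Lambda] elements, living in some model [N].  If [A] and realizations
    of all types over it were algebraic over a set of [Lambda]-many members of
    an indiscernible set, this would be clear: an algebraic tuple [x] satisfies
    a formula [phi] over the sequences and [A] with the least possible number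
    of solutions, and the type of [x] over [A] is then the set of all [theta]
    implied by [phi], so that there are no more types than formulas.  Since
    [M] may be too small to contain [A], the elements in question are not taken
    from a model, but are variables; a type in home variables [V] and sequence
    variables [Y] is an ultrafilter on the set of assignments of elements of [M]
    and of members of [X] to these variables ([ae], [generic], [algebraic]).
    Compactness is then the extension of filters to ultrafilters.

    The key is [realize_by_algebraic].  Given such a type in which the elements
    of [K] are algebraic over the sequences in [J], a further element [v0] can be
    changed, without changing its home type over [K], to one which is algebraic
    over [J] and countably many new sequences.  If not, each algebraic formula
    with parameters in [J] is excluded by some property of [v0], and closing off
    gives subsets of [K] and [J] with at most [Tau] elements for which the same
    fails.  These can be found inside [M] ([realize_algebraic]); by saturation
    [v0] is realized there, by an element which, like every element of [M], is
    algebraic over the given sequences and finitely many others.  The others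
    may be replaced by the new ones, since sequences outside a given set remain
    indiscernible over everything algebraic over that set
    ([indiscernible_over_algebraic]), and this is a contradiction.

    Zorn's lemma then makes all elements of a configuration algebraic, relative
    to a part which is algebraic already ([extend_algebraic]), and the types are
    counted as above ([injects_type_space]).

    If [T] is countable, it follows that [T] is stable in the countable cardinal.
    A formula without Morley rank splits into two disjoint ones without Morley
    rank; the tree obtained by iterating this would give continuum many types
    over a countable set ([ranked_of_stable]). *)

(** * Infinite cardinals *)

(** Comparison of types rather than of subsets, for use with products, lists and
    trees. *)
Definition injects (X Y : Type) : Prop := exists f : X -> Y, injective f.

Lemma injects_refl X : injects X X.
Proof. by exists id. Qed.

Lemma injects_trans X Y Z : injects X Y -> injects Y Z -> injects X Z.
Proof.
by move=> [f fI] [g gI]; exists (g \o f); exact: inj_comp.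
Qed.

Lemma card_le_injects X Y (A : set X) (B : set Y) : A #<= B <-> injects A B.
Proof.
split=> [/card_leP[f]|[f fI]].
  by exists f => x y; apply: inj; rewrite in_setT.
apply/card_leP/injfunPex; exists f => // x y _ _; exact: fI.
Qed.

Lemma injects_setT X : injects [set: X] X.
Proof. by exists val; exact: val_inj. Qed.

Lemma injects_to_setT X : injects X [set: X].
Proof.
by exists (fun x => exist _ x (mem_set I)) => x y [].
Qed.

Lemma card_le_setT X Y (A : set X) : A #<= [set: Y] <-> injects A Y.
Proof.
rewrite card_le_injects; split=> h; apply: injects_trans h _.
  exact: injects_setT.
exact: injects_to_setT.
Qed.

Lemma card_leTT X Y : [set: X] #<= [set: Y] <-> injects X Y.
Proof.
rewrite card_le_setT; split; apply: injects_trans.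
  exact: injects_to_setT.
exact: injects_setT.
Qed.

Lemma injects_sub X (A B : set X) : A `<=` B -> injects A B.
Proof. by move=> /subset_card_le/card_le_injects. Qed.

Lemma injects_set X (A : set X) : injects A X.
Proof. by exists val; exact: val_inj. Qed.

Lemma injects_rel X Y (R : X -> Y -> Prop) :
  (forall x, exists y, R x y) -> (forall x x' y, R x y -> R x' y -> x = x') ->
  injects X Y.
Proof.
move=> /choice[f Rf] RI; exists f => x x' e; apply: RI (Rf x) _.
by rewrite e; exact: Rf.
Qed.

(** A maximal injective partial function is total or surjective. *)
Lemma injects_total X Y : injects X Y \/ injects Y X.
Proof.
pose P (G : set (X * Y)) := forall p q, G p -> G q -> (p.1 = q.1 <-> p.2 = q.2).
have [F FP Ftot|G [GP Gmax]] := @Zorn_bigcup _ P.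
  move=> p q [A FA Ap] [B FB Bq].
  have [/(_ p Ap) Bp|/(_ q Bq) Aq] := Ftot _ _ FA FB; first exact: (FP B).
  exact: (FP A).
case: (pselect (forall x, exists y, G (x, y))) => [Gx|].
  left; apply: (injects_rel Gx) => x x' y p q.
  by apply/(GP _ _ p q).
case: (pselect (forall y, exists x, G (x, y))) => [Gy _|].
  right; apply: (injects_rel Gy) => y y' x p q.
  by apply/(GP _ _ p q).
move=> /existsNP[y Gy] /existsNP[x Gx]; exfalso.
apply: (Gmax (G `|` [set (x, y)])).
  split; first by move=> p Gp; left.
  by move=> /(_ (x, y)) h; apply: Gx; exists y; apply: h; right.
move=> [a b] [c d] [Gp|[-> ->]] [Gq|[-> ->]] //=; first exact: (GP _ _ Gp Gq).
  split=> e; first by case: Gx; exists b; rewrite -e.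
  by case: Gy; exists a; rewrite -e.
split=> e; first by case: Gx; exists d; rewrite e.
by case: Gy; exists c; rewrite e.
Qed.

Lemma injects_prod X X' Y Y' :
  injects X X' -> injects Y Y' -> injects (X * Y) (X' * Y').
Proof.
move=> [f fI] [g gI]; exists (fun p => (f p.1, g p.2)).
by move=> [a b] [c d] /= [/fI -> /gI ->].
Qed.

Definition infinite (X : Type) := injects nat X.

(** Among the injections of squares [S * S -> S], with [S] a subset of [X]
    containing a countable one, take a maximal one; if the complement of [S]
    contained a copy [S'] of [S], the injection could be extended to
    [S `|` S'], the three new blocks being sent into [S'].  So the complement
    injects into [S], and [X] into [S + S]. *)
Lemma injects_square X : infinite X -> injects (X * X) X.
Proof.
move=> [i iI].
pose isq (G : set ((X * X) * X)) (S : set X) :=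
  [/\ forall n, S (i n),
      forall p q, G p -> G q -> (p.1 = q.1 <-> p.2 = q.2),
      forall x y, S x -> S y -> exists z, G ((x, y), z) &
      forall p, G p -> [/\ S p.1.1, S p.1.2 & S p.2]].
pose P G := exists S, isq G S.
(* the empty graph is admitted as the union of the empty chain *)
have [F FP Ftot|G [[G0|[S [Si GI GS SG]]] Gmax]] := @Zorn_bigcup _ (fun G => G = set0 \/ P G).
  case: (pselect (exists2 G, F G & G !=set0)); last first.
    move=> h; left; apply/seteqP; split=> // p [A FA Ap]; apply: h.
    by exists A => //; exists p.
  move=> [G0 FG0 [p0 G0p0]]; right.
  have FP' A p : F A -> A p -> P A.
    by move=> FA Ap; case: (FP _ FA) => // A0; rewrite A0 in Ap.
  exists [set x | exists2 A, F A & exists y, A ((x, x), y)].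
  split.
  - move=> n; exists G0 => //; have [S [Si _ GS _]] := FP' _ _ FG0 G0p0.
    exact: GS.
  - move=> p q [A FA Ap] [B FB Bq].
    have [/(_ p Ap) Bp|/(_ q Bq) Aq] := Ftot _ _ FA FB.
      by have [S [_ + _ _]] := FP' _ _ FB Bq; exact.
    by have [S [_ + _ _]] := FP' _ _ FA Ap; exact.
  - move=> x y [A FA [z Az]] [B FB [t Bt]].
    have [/(_ _ Az) Bz|/(_ _ Bt) At] := Ftot _ _ FA FB.
      have [S [_ _ GS SG]] := FP' _ _ FB Bt.
      have [u Bu] : exists u, B ((x, y), u).
        by apply: GS; [case: (SG _ Bz)|case: (SG _ Bt)].
      by exists u; exists B.
    have [S [_ _ GS SG]] := FP' _ _ FA Az.
    have [u Au] : exists u, A ((x, y), u).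
      by apply: GS; [case: (SG _ Az)|case: (SG _ At)].
    by exists u; exists A.
  - move=> p [A FA Ap]; have [S [_ _ GS SG]] := FP' _ _ FA Ap.
    have [S1 S2 S3] := SG _ Ap.
    by split; exists A => //; exact: GS.
- (* the empty graph is not maximal, for [nat * nat] injects into [nat] *)
  exfalso.
  pose D : set X := [set x | exists n, x = i n].
  pose c (p : nat * nat) := i (pickle p).
  have cI : injective c by move=> p q /iI/(pcan_inj pickleK).
  apply: (Gmax [set p | exists q : nat * nat, p = ((i q.1, i q.2), c q)]).
    split; first by rewrite G0.
    by move=> h; have := h ((i 0, i 0), c (0, 0)); rewrite G0; apply; exists (0,0).
  right; exists D; split.
  - by move=> n; exists n.
  - move=> _ _ [[a b] ->] [[a' b'] ->] /=; split.
      by move=> [/iI -> /iI ->].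
    by move=> /cI [-> ->].
  - by move=> _ _ [a ->] [b ->]; exists (c (a, b)); exists (a, b).
  - by move=> _ [[a b] ->] /=; split; eexists; reflexivity.
have SS : injects (S * S) S.
  apply: (injects_rel (R := fun (p : S * S) (z : S) => G ((val p.1, val p.2), val z))).
    move=> [[x Sx] [y Sy]] /=; have [z Gz] := GS _ _ (set_mem Sx) (set_mem Sy).
    have [_ _ Sz] := SG _ Gz.
    by exists (exist _ z (mem_set Sz)).
  move=> [[x Sx] [y Sy]] [[x' Sx'] [y' Sy']] [z Sz] /= h h'.
  have /GI := h => /(_ _ h') /= [_ /(_ erefl)][ex ey].
  by congr (_, _); apply: val_inj.
have S2 : injects (bool * S) S.
  apply: injects_trans SS; apply: injects_prod (injects_refl _).
  exists (fun b : bool => exist _ (i b) (mem_set (Si b)) : S).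
  by move=> [] [] // [/iI].
have S3 : injects (option bool * S) S.
  apply: injects_trans SS; apply: injects_prod (injects_refl _).
  pose g (b : option bool) : nat := if b is Some c then c.+1 else 0.
  have gI : injective g by do 2![case=> [[]|]].
  exists (fun b => exist _ (i (g b)) (mem_set (Si (g b))) : S).
  by move=> b b' [/iI/gI].
have [CS|] := injects_total (~` S) S.
  have XS : injects X S.
    apply: injects_trans S2; have [f fI] := CS.
    apply: (injects_rel (R := fun x (p : bool * S) =>
      (p.1 = true /\ x = val p.2) \/
      (p.1 = false /\ exists y : (~` S), x = val y /\ p.2 = f y))).
      move=> x; case: (pselect (S x)) => Sx.
        by exists (true, exist _ x (mem_set Sx)); left.
      exists (false, f (exist _ x (mem_set Sx))); right; split=> //.
      by exists (exist _ x (mem_set Sx)).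
    move=> x x' [b s] /= [[-> ->]|[-> [y [-> ->]]]] [[//= _ ->]|[//= _ [y' [-> e]]]] //.
    by rewrite (fI _ _ e).
  apply: injects_trans (injects_prod XS XS) _.
  exact: injects_trans SS (injects_set _).
move=> [g gI]; exfalso.
have [h hI] := injects_trans (injects_prod (injects_refl (option bool)) SS) S3.
pose S' : set X := [set x | exists s, x = val (g s)].
have S'N x : S' x -> ~ S x.
  by move=> [s ->]; exact: set_mem (valP (g s)).
(* [s] is the copy in [S] of the element [x] of [S `|` S'], and [b] tells whether
   [x] lies in [S'] *)
pose R (x : X) (b : bool) (s : S) :=
  if b then x = val (g s) else x = val s.
have RI x b b' s s' : R x b s -> R x b' s' -> b = b' /\ s = s'.
  case: b b' => [] [] /= -> e.
  - by split=> //; apply/gI/val_inj.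
  - exfalso; apply: (S'N (val (g s))); first by exists s.
    exact: (eq_ind_r S (set_mem (valP s')) e).
  - exfalso; apply: (S'N (val (g s'))); first by exists s'.
    exact: (eq_ind _ S (set_mem (valP s)) _ e).
  - by split=> //; apply/val_inj.
have RF x x' b s : R x b s -> R x' b s -> x = x'.
  by case: b => /= -> ->.
have RE x : (S `|` S') x -> exists b s, R x b s.
  move=> [Sx|[s ->]]; last by exists true, s.
  by exists false, (exist _ x (mem_set Sx)).
pose bb (b c : bool) : option bool :=
  if b then (if c then None else Some true) else Some false.
pose G' : set ((X * X) * X) := [set p | exists b c s t,
   [/\ R p.1.1 b s, R p.1.2 c t, b || c & p.2 = val (g (h (bb b c, (s, t))))]].
have G'S' p : G' p -> S' p.2.
  by move=> [b [c [s [t [_ _ _ ->]]]]]; eexists.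
have GG' p q : G p -> G' q -> ~ (p.1 = q.1) /\ ~ (p.2 = q.2).
  move=> Gp G'q; split=> e; last first.
    by apply: (S'N p.2); [rewrite e; exact: G'S'|case: (SG _ Gp)].
  have [p1 p2 _] := SG _ Gp; move: p1 p2.
  have [b [c [s [t [+ + bc _]]]]] := G'q; rewrite -e.
  case: b bc => [_|/= ->] /=.
    by move=> -> _ Sg _; apply: S'N Sg; eexists.
  by move=> _ -> _ Sg; apply: S'N Sg; eexists.
apply: (Gmax (G `|` G')).
  split; first by move=> p Gp; left.
  pose y := val (g (exist _ (i 0) (mem_set (Si 0)))).
  have Ry : R y true (exist _ (i 0) (mem_set (Si 0))) by [].
  have G'y : G' ((y, y), val (g (h (bb true true, (exist _ (i 0) (mem_set (Si 0)), exist _ (i 0) (mem_set (Si 0))))))).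
    by do 4!eexists; split; [exact: Ry|exact: Ry| |reflexivity].
  move=> sub; have [Sy _ _] := SG _ (sub _ (or_intror G'y)).
  by apply: (S'N y) => //; eexists.
right; exists (S `|` S'); split.
- by move=> n; left.
- move=> p q [Gp|G'p] [Gq|G'q].
  + exact: GI.
  + by have [n1 n2] := GG' _ _ Gp G'q; split=> e.
  + by have [n1 n2] := GG' _ _ Gq G'p; split=> e; [case: n1|case: n2].
  + move: p q G'p G'q => [[p1 p2] p3] [[q1 q2] q3].
    move=> [b [c [s [t /= [Rp1 Rp2 bc ->]]]]] [b' [c' [s' [t' /= [Rq1 Rq2 bc' ->]]]]].
    split=> [[e1 e2]|/val_inj/gI/hI].
      rewrite -e1 in Rq1; rewrite -e2 in Rq2.
      by have [-> ->] := RI _ _ _ _ _ Rp1 Rq1; have [-> ->] := RI _ _ _ _ _ Rp2 Rq2.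
    case=> eb es et.
    have [eb1 ec1] : b = b' /\ c = c'.
      by move: eb bc bc'; case: (b) (c) (b') (c') => [] [] [] [].
    subst b' c' s' t'; congr (_, _).
      exact: RF Rp1 Rq1.
    exact: RF Rp2 Rq2.
- move=> x y Ux Uy.
  case: (pselect (S x /\ S y)) => [[Sx Sy]|nS].
    by have [z Gz] := GS _ _ Sx Sy; exists z; left.
  have [b [s Rx]] := RE _ Ux; have [c [t Ry]] := RE _ Uy.
  exists (val (g (h (bb b c, (s, t))))); right.
  exists b, c, s, t; split=> //.
  case: b c Rx Ry => [] [] //= ex ey; case: nS; rewrite ex ey.
  by split; exact: set_mem (valP _).
- move=> p [Gp|G'p].
    by have [S1 S2' S3'] := SG _ Gp; split; left.
  have := G'S' _ G'p; have [b [c [s [t [Rp1 Rp2 bc _]]]]] := G'p => S'p.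
  by split; [| |by right];
    [move: Rp1; case: (b)|move: Rp2; case: (c)] => /= ->;
    [right; eexists|left; exact: set_mem (valP _)|right; eexists|left; exact: set_mem (valP _)].
Qed.

(** * Finite lists and finite sets of bounded size *)

Notation In := List.In.

Lemma In_nth_error T (x : T) s : In x s -> exists n, onth s n = Some x.
Proof.
elim: s => //= y s IH [->|/IH[n sn]]; first by exists 0.
by exists n.+1.
Qed.

Lemma list_filter T (A : T -> Prop) (s : seq T) :
  exists t : seq T, forall x, In x t <-> In x s /\ A x.
Proof.
elim: s => [|x s [t tP]]; first by exists [::] => x; split=> // -[].
case: (pselect (A x)) => Ax; [exists (x :: t)|exists t] => y /=; rewrite tP.
  by split=> [[<-|[ys Ay]]|[[<-|ys] Ay]];
    [split=> //; left|split=> //; right|left|right].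
split=> [[ys Ay]|[[xy|ys] Ay]]; [by split=> //; right| |by []].
by rewrite -xy in Ay.
Qed.

Lemma mem_In (T : eqType) (x : T) s : x \in s -> In x s.
Proof. by elim: s => //= y s IH; rewrite inE => /orP[/eqP ->|/IH]; [left|right]. Qed.

Lemma onth_nth_map T U (f : T -> U) s i x d : onth s i = Some x -> nth d (map f s) i = f x.
Proof. by elim: s i => [|y s IH] [|i] //= => [[->]//|/IH]. Qed.

Lemma In_cat T (x : T) s t : In x (s ++ t) <-> In x s \/ In x t.
Proof. by split=> [h|]; [exact: List.in_app_or h|exact: List.in_or_app]. Qed.

Lemma In_pmap T U (f : T -> option U) s x y : In x s -> f x = Some y -> In y (pmap f s).
Proof.
move=> + fx; elim: s => //= z s IH [->|/IH xs] /=; first by rewrite fx; left.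
by case: (f z) => //= u; right.
Qed.

Lemma In_flatten_ord T k (s : 'I_k -> seq T) i x :
  In x (s i) -> In x (flatten [seq s j | j <- enum 'I_k]).
Proof.
have : i \in enum 'I_k by rewrite mem_enum.
elim: (enum 'I_k) => //= j js IH; rewrite inE => /orP[/eqP <-|/IH h] xs.
  by apply/List.in_or_app; left.
by apply/List.in_or_app; right; exact: h.
Qed.

Lemma In_nth_ex T (x0 x : T) s : In x s -> exists2 i, (i < size s)%N & nth x0 s i = x.
Proof.
elim: s => //= y s IH [->|/IH[i ilt xi]]; first by exists 0.
by exists i.+1.
Qed.

Lemma bounded_list (T : Type) (m : seq (T + nat)) :
  exists k, forall n, In (inr n) m -> (n < k)%N.
Proof.
elim: m => [|z m [k kP]]; first by exists 0.
exists (maxn k (if z is inr n then n.+1 else 0)) => n /= [->|/kP nk].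
  exact: leq_maxr.
exact: leq_trans nk (leq_maxl _ _).
Qed.

Lemma tail_avoids X (h : nat -> X) (s : seq X) : injective h ->
  exists m, forall n, ~ In (h (m + n)) s.
Proof.
move=> hI; elim: s => [|x s [m mP]]; first by exists 0 => n.
case: (pselect (exists i, h i = x)) => [[i ix]|xh]; last first.
  by exists m => n [e|/mP//]; apply: xh; exists (m + n).
exists (m + i.+1) => n [e|]; last by rewrite -addnA; exact: mP.
have ilt : (i < m + i.+1 + n)%N := leq_trans (leq_addl m i.+1) (leq_addr n _).
by move: ilt; rewrite -(hI i (m + i.+1 + n)) ?ltnn // ix.
Qed.

Definition atmost T (N : nat) (S : T -> Prop) :=
  exists2 s : seq T, (size s <= N)%N & forall x, S x -> In x s.

Lemma atmost_sub T N (S S' : T -> Prop) :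
  (forall x, S' x -> S x) -> atmost N S -> atmost N S'.
Proof. by move=> SS [s sN sS]; exists s => // x /SS/sS. Qed.

Lemma atmost0 T (S : T -> Prop) : atmost 0 S <-> forall x, ~ S x.
Proof.
split=> [[s + sS] x /sS|S0]; first by case: s {sS}.
by exists [::] => // x /S0.
Qed.

(** The recursion which makes the bound [N] on the number of solutions expressible
    by a first-order formula. *)
Lemma atmostS T N (S : T -> Prop) : inhabited T ->
  atmost N.+1 S <-> exists a, atmost N (fun x => S x /\ x <> a).
Proof.
move=> [x0]; split=> [[[|a s] sN sS]|[a [s sN sS]]].
- by exists x0, [::] => // x [/sS].
- by exists a, s => // x [/sS [->|]].
- exists (a :: s) => // x Sx; case: (pselect (x = a)) => [->|xa]; first by left.
  by right; exact: sS.
Qed.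

Lemma atmost_drop T N (S S' : T -> Prop) a : (forall x, S' x -> S x) ->
  S a -> ~ S' a -> atmost N.+1 S -> atmost N S'.
Proof.
move=> SS Sa S'a [s sN sS]; have [s1 [s2 es]] := List.in_split a s (sS _ Sa).
exists (s1 ++ s2).
  by move: sN; rewrite es !size_cat /= addnS ltnS.
move=> x S'x; have := sS _ (SS _ S'x); rewrite es !In_cat => -[h|[ax|h]].
- by left.
- by move: S'x; rewrite -ax.
- by right.
Qed.

(** The bound depends only on the bounds [N i], so it is uniform when the sets [S i]
    vary. *)
Lemma atmost_tuples n (N : 'I_n -> nat) : exists N', forall T (S : 'I_n -> T -> Prop),
  (forall i, atmost (N i) (S i)) -> atmost N' (fun x : 'I_n -> T => forall i, S i (x i)).
Proof.
pose N0 := \max_i N i.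
exists #|{ffun 'I_n -> 'I_N0}| => T S SN.
case: (pselect (exists x : 'I_n -> T, forall i, S i (x i))) => [[x0 x0S]|nx]; last first.
  by exists [::] => // x xS; case: nx; exists x.
have /choice[s sP] : forall i, exists s : seq T, (size s <= N0)%N /\ forall x, S i x -> In x s.
  move=> i; have [s sN sS] := SN i; exists s; split=> //.
  exact: leq_trans sN (leq_bigmax i).
exists [seq (fun i => nth (x0 i) (s i) (g i)) | g : {ffun 'I_n -> 'I_N0} <- enum {ffun 'I_n -> 'I_N0}].
  by rewrite size_map -cardE.
move=> x xS.
have /choice[g gP] : forall i, exists k : 'I_N0, nth (x0 i) (s i) k = x i.
  move=> i; have [sN sS] := sP i; have [k ks kx] := In_nth_ex (x0 i) (sS _ (xS i)).
  by exists (Ordinal (leq_trans ks sN)).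
have -> : x = (fun g : {ffun 'I_n -> 'I_N0} => fun i => nth (x0 i) (s i) (g i)) (finfun g).
  by apply: funext => i; rewrite ffunE gP.
by apply: List.in_map; apply: mem_In; rewrite mem_enum.
Qed.

Lemma finite_set_list T (A : set T) : finite_set A ->
  exists s : seq T, forall x, A x -> In x s.
Proof.
case=> n; rewrite card_eq_le => /andP[/card_le_injects[f fI] _].
have /choice[g gP] : forall k : nat, exists o : option T,
    forall x : A, val (f x) = k -> o = Some (val x).
  move=> k; case: (pselect (exists x, val (f x) = k)) => [[x xk]|nk].
    exists (Some (val x)) => y yk; congr (Some (val _)).
    by apply/fI/val_inj; rewrite xk yk.
  by exists None => x xk; case: nk; exists x.
exists (pmap g (iota 0 n)) => x Ax; pose y : A := exist _ x (mem_set Ax).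
have yn : (val (f y) < n)%N by have := set_mem (valP (f y)).
apply: (In_pmap (x := val (f y))); last exact: gP y erefl.
by apply: mem_In; rewrite mem_iota.
Qed.

Lemma least_nat (P : nat -> Prop) : (exists n, P n) ->
  exists2 n, P n & forall m, P m -> (n <= m)%N.
Proof.
move=> [n Pn]; have ex : exists n, `[< P n >] by exists n; apply/asboolP.
exists (ex_minn ex); case: ex_minnP => m /asboolP Pm mP //.
by move=> k Pk; apply: mP; apply/asboolP.
Qed.

(** * Small closures *)

Lemma injects_prod_into X Y Z :
  infinite Z -> injects X Z -> injects Y Z -> injects (X * Y) Z.
Proof.
move=> Zinf XZ YZ; exact: injects_trans (injects_prod XZ YZ) (injects_square Zinf).
Qed.

Lemma injects_sum_into X Y Z :
  infinite Z -> injects X Z -> injects Y Z -> injects (X + Y) Z.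
Proof.
move=> Zinf [f fI] [g gI]; have [i iI] := Zinf.
apply: injects_trans (injects_square Zinf).
exists (fun p => match p with inl x => (i 0, f x) | inr y => (i 1, g y) end).
by move=> [x|y] [x'|y'] [] => [/fI ->|/iI|/iI|/gI ->].
Qed.

Lemma injects_seq X Z : infinite Z -> injects X Z -> injects (seq X) Z.
Proof.
move=> Zinf [f fI]; have [i iI] := Zinf; have [p pI] := injects_square Zinf.
(* the end of the list is not visible in [code], hence the length is recorded *)
pose code := foldr (fun x z => p (f x, z)) (i 0).
exists (fun s => p (i (size s), code s)) => s t /pI [/iI].
elim: s t => [|x s IH] [|y t] //= [est] /pI [/fI -> /(IH _ est) ->//].
Qed.

Lemma injects_tree X Z : infinite Z -> injects X Z -> injects (GenTree.tree X) Z.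
Proof.
move=> Zinf XZ; apply: (@injects_trans _ (seq (nat + X))).
  exists (@GenTree.encode X); exact: pcan_inj (@GenTree.codeK X).
exact/injects_seq/injects_sum_into.
Qed.

Lemma injects_seq_image X Y Z (G : X -> seq Y) :
  infinite Z -> injects X Z -> injects [set y | exists x, In y (G x)] Z.
Proof.
move=> Zinf XZ; apply: (@injects_trans _ (X * nat)); last exact: injects_prod_into.
apply: (injects_rel (R := fun y p => onth (G p.1) p.2 = Some (val y))).
  move=> [y yG]; have [x yx] := set_mem yG; have [n xn] := In_nth_error yx.
  by exists (x, n).
by move=> y y' p /= -> [e]; exact: val_inj.
Qed.

Lemma injects_setU X Z (A B : set X) :
  infinite Z -> injects A Z -> injects B Z -> injects (A `|` B) Z.
Proof.
move=> Zinf AZ BZ; apply: (@injects_trans _ (A + B)); last exact: injects_sum_into.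
pose g (p : A + B) : X := match p with inl x => val x | inr y => val y end.
apply: (injects_rel (R := fun y p => g p = val y)).
  move=> [y yAB]; case: (set_mem yAB) => [Ay|By].
    by exists (inl (exist _ y (mem_set Ay))).
  by exists (inr (exist _ y (mem_set By))).
by move=> y y' p /= -> e; exact: val_inj.
Qed.

Lemma injects_bigcup X Z (A : nat -> set X) :
  infinite Z -> (forall n, injects (A n) Z) -> injects (\bigcup_n A n) Z.
Proof.
move=> Zinf AZ; apply: (@injects_trans _ (nat * Z)); last first.
  exact/injects_prod_into/injects_refl.
pose f n := sval (cid (AZ n)); have fI n : injective (f n) := svalP (cid (AZ n)).
apply: (injects_rel (R := fun x p =>
  exists Ax : val x \in A p.1, f p.1 (exist _ (val x) Ax) = p.2)).
  move=> [x /= xA]; have [n _ Ax] := set_mem xA.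
  by exists (n, f n (exist _ x (mem_set Ax))), (mem_set Ax).
move=> x x' [n z] [/= Ax <-] [Ax' /fI [exx']].
exact: val_inj.
Qed.

Lemma lift_seq X (A : set X) (s : seq X) (sA : forall x, In x s -> A x) :
  exists t : seq A, s = [seq val x | x <- t].
Proof.
elim: s sA => [|x s IH] sA; first by exists [::].
have [|t ->] := IH; first by move=> y ys; apply: sA; right.
by exists (exist _ x (mem_set (sA x (or_introl erefl))) :: t).
Qed.

(** A set closed under [Z]-many finitary operations, built in countably many
    stages as in the downward Loewenheim-Skolem theorem. *)
Lemma small_closure C Y Z (G : C -> seq Y -> seq Y) :
  infinite Z -> injects C Z ->
  exists S : set Y, injects S Z /\
    forall c ys, (forall y, In y ys -> S y) -> forall y, In y (G c ys) -> S y.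
Proof.
move=> Zinf CZ.
pose next (S : set Y) : set Y := S `|`
  [set y | exists p : C * seq S, In y (G p.1 [seq val x | x <- p.2])].
pose S n := iter n next set0.
have SZ n : injects (S n) Z.
  elim: n => [|n IH].
    apply: (injects_rel (R := fun x y => False)) => //.
    by move=> [y y0]; case: (set_mem y0).
  apply: injects_setU => //.
  by apply: injects_seq_image => //; apply: injects_prod_into => //; exact: injects_seq.
exists (\bigcup_n S n); split; first exact: injects_bigcup.
have Smono m n : (m <= n)%N -> S m `<=` S n.
  move=> /subnKC <-; elim: (n - m)%N => [|k IH]; first by rewrite addn0.
  by rewrite addnS => x /IH Sx; left.
move=> c ys ysS y yG.
have [n ysn] : exists n, forall x, In x ys -> S n x.
  elim: (ys) ysS => [|x xs IH] xS; first by exists 0.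
  have [|n nS] := IH; first by move=> z zs; apply: xS; right.
  have [m _ mS] := xS _ (or_introl erefl).
  exists (maxn m n) => z [<-|/nS]; first exact: Smono (leq_maxl _ _) _ mS.
  exact: Smono (leq_maxr _ _) _.
exists n.+1 => //; right; have [t et] := lift_seq ysn.
by exists (c, t) => /=; rewrite -et.
Qed.

Lemma infinite_finType (F : finType) X (f : X -> F) :
  infinite X -> exists x y, x <> y /\ f x = f y.
Proof.
move=> [i iI]; apply: contrapT => nf.
have fI : injective (f \o i).
  move=> m n /= e; apply: contrapT => mn; apply: nf.
  by exists (i m), (i n); split=> // /iI.
pose g (k : 'I_#|F|.+1) := f (i k).
have gI : injective g by move=> j k /fI /val_inj.
by have := leq_card g gI; rewrite card_ord ltnn.
Qed.

(** * First-order formulas *)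

Definition upd V M (v : V -> M) (x : V) (a : M) (y : V) : M :=
  if `[< y = x >] then a else v y.

Definition bind V (x y : V) : option V := if `[< y = x >] then None else Some y.

Lemma oapp_bind V M (v : V -> M) x a : oapp v a \o bind x = upd v x a.
Proof. by apply: funext => y; rewrite /bind /upd /=; case: asboolP. Qed.

Lemma upd_same V M (v : V -> M) x a : upd v x a x = a.
Proof. by rewrite /upd; case: asboolP. Qed.

Lemma upd_neq V M (v : V -> M) x a y : y <> x -> upd v x a y = v y.
Proof. by rewrite /upd; case: asboolP. Qed.

(** Only finitely many restrictions to [l] are possible for a choice function. *)
Lemma finite_choices V M (S : V -> M -> Prop) (l : seq V) (b : V -> M) :
  (forall v, In v l -> exists N, atmost N (S v)) ->
  exists B : seq (V -> M), forall c, (forall v, In v l -> S v (c v)) ->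
    exists2 c', In c' B & forall v, In v l -> c' v = c v.
Proof.
elim: l => [|v l IH] Sf; first by exists [:: b] => c _; exists b => //; left.
have [|B BP] := IH; first by move=> u ul; apply: Sf; right.
have [N [s _ sS]] := Sf v (or_introl erefl).
exists (List.flat_map (fun c => [seq upd c v x | x <- s]) B) => c cS.
have [|c' c'B c'c] := BP c; first by move=> u ul; apply: cS; right.
exists (upd c' v (c v)).
  apply/List.in_flat_map; exists c'; split=> //.
  apply: (List.in_map (upd c' v)); apply: sS; apply: cS; by left.
move=> u ul; case: (pselect (u = v)) => [->|uv]; first by rewrite upd_same.
by rewrite upd_neq //; apply: c'c; case: ul => // /esym.
Qed.

Section FirstOrder.
Variable L : language.

Fixpoint trename V W (f : V -> W) (t : term L V) : term L W :=
  match t with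
  | Var x => Var (f x)
  | App g args => App g (fun i => trename f (args i))
  end.

Fixpoint frename V W (f : V -> W) (phi : formula L V) : formula L W :=
  match phi with
  | Bot => Bot
  | Eq t u => Eq (trename f t) (trename f u)
  | Rel r args => Rel r (fun i => trename f (args i))
  | Imp psi chi => Imp (frename f psi) (frename f chi)
  | All psi => All (frename (omap f) psi)
  end.

Lemma eval_trename (K : structure L) V W (f : V -> W) (v : W -> K) t :
  eval v (trename f t) = eval (v \o f) t.
Proof.
elim: t => //= g args IH; congr finterp; exact: funext.
Qed.

Lemma sat_frename (K : structure L) V W (f : V -> W) (v : W -> K) phi :
  sat v (frename f phi) <-> sat (v \o f) phi.
Proof.
elim: V / phi W f v => //= V.
- by move=> t u W f v; rewrite !eval_trename.
- move=> r args W f v; suff -> : (fun i => eval v (trename f (args i))) =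
    (fun i => eval (v \o f) (args i)) by [].
  by apply: funext => i; rewrite eval_trename.
- by move=> psi IH1 chi IH2 W f v; rewrite IH1 IH2.
- move=> psi IH W f v; split=> h a; have := h a; rewrite IH;
    suff -> : oapp v a \o omap f = oapp (v \o f) a by [].
  all: by apply: funext => -[].
Qed.

Lemma term_support V (t : term L V) : exists l : seq V,
  forall (K : structure L) (v w : V -> K),
    (forall x, In x l -> v x = w x) -> eval v t = eval w t.
Proof.
elim: t => [x|g args /choice[s sP]].
  by exists [:: x] => K v w vw /=; apply: vw; left.
exists (flatten [seq s j | j <- enum 'I_(fsym_arity g)]) => K v w vw /=.
congr finterp; apply: funext => i; apply: sP => x xs.
exact/vw/In_flatten_ord/xs.
Qed.

Lemma formula_support V (phi : formula L V) : exists l : seq V,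
  forall (K : structure L) (v w : V -> K),
    (forall x, In x l -> v x = w x) -> sat v phi <-> sat w phi.
Proof.
elim: V / phi => V.
- by exists [::].
- move=> t u; have [l lP] := term_support t; have [m mP] := term_support u.
  exists (l ++ m) => K v w vw /=.
  rewrite (lP _ _ w) ?(mP _ _ w) // => x xl; apply/vw/List.in_or_app; first by right.
  by left.
- move=> r args.
  have /choice[s sP] := fun i => term_support (args i).
  exists (flatten [seq s j | j <- enum 'I_(rsym_arity r)]) => K v w vw /=.
  suff -> : (fun i => eval v (args i)) = (fun i => eval w (args i)) by [].
  apply: funext => i; apply: sP => x xs.
  exact/vw/In_flatten_ord/xs.
- move=> psi [l lP] chi [m mP]; exists (l ++ m) => K v w vw /=.
  rewrite (lP _ _ w) ?(mP _ _ w) // => x xl; apply/vw/List.in_or_app; first by right.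
  by left.
- move=> psi [l lP]; exists (pmap id l) => K v w vw /=.
  suff vw' a : sat (oapp v a) psi <-> sat (oapp w a) psi.
    by split=> h a; apply/vw'.
  by apply: lP => -[x|] //= xl; exact/vw/(In_pmap xl).
Qed.

Definition And V (phi psi : formula L V) := Neg (Imp phi (Neg psi)).

Lemma satAE (K : structure L) V (v : V -> K) phi psi :
  sat v (And phi psi) <-> sat v phi /\ sat v psi.
Proof.
split=> [h|[h1 h2] /(_ h1 h2)//].
by apply: contrapT => nh; apply: h => h1 h2; exact: nh.
Qed.

Definition exq V (x : V) (phi : formula L V) : formula L V :=
  Neg (All (Neg (frename (bind x) phi))).

Lemma sat_exq (K : structure L) V (v : V -> K) x phi :
  sat v (exq x phi) <-> exists a, sat (upd v x a) phi.
Proof.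
split=> [h|[a h] /(_ a) nh].
  apply: contrapT => nh; apply: h => a /sat_frename h; apply: nh; exists a.
  by rewrite -oapp_bind.
by apply: nh; apply/sat_frename; rewrite oapp_bind.
Qed.

Fixpoint exqs V (l : seq V) (phi : formula L V) : formula L V :=
  if l is x :: l' then exq x (exqs l' phi) else phi.

Lemma sat_exqs (K : structure L) V (v : V -> K) l phi :
  sat v (exqs l phi) <->
  exists2 w : V -> K, (forall x, ~ In x l -> w x = v x) & sat w phi.
Proof.
elim: l v => [|x l IH] v; rewrite [exqs _ _]/=.
  split=> [h|[w wv h]]; first by exists v.
  by have <- : w = v by apply: funext => x; exact: wv.
rewrite sat_exq; split=> [[a /IH[w wv h]]|[w wv h]].
  exists w => // y yn; rewrite wv => [|yl]; last by apply: yn; right.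
  by rewrite upd_neq // => yx; apply: yn; left.
exists (w x); apply/IH; exists w => // y yl.
case: (pselect (y = x)) => [->|yx]; first by rewrite upd_same.
by rewrite upd_neq //; apply: wv => -[/esym|].
Qed.

(** A formula is satisfiable in [K] iff [K] satisfies the sentence obtained by
    quantifying existentially the finitely many variables that matter; the
    others may all be replaced by a single, universally quantified one. *)
Lemma sat_transfer (T : theory L) (K K' : structure L) V (phi : formula L V) :
  complete T -> models K T -> models K' T ->
  (exists v : V -> K, sat v phi) -> exists v : V -> K', sat v phi.
Proof.
move=> [_ Tc] KT KT' [v vphi]; have [l lP] := formula_support phi.
pose sigma : formula L void := All (frename (fun=> None) (exqs l phi)).
have sigmaE (N : structure L) : sat (of_void N) sigma <-> exists v : V -> N, sat v phi.
  split=> [h|[w wphi] a /=].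
    have [a] := carrier_inhabited N; have := h a => /sat_frename/sat_exqs[w _].
    by exists w.
  apply/sat_frename/sat_exqs.
  pose g x := if `[< In x l >] then w x else a.
  have gw x : In x l -> g x = w x by rewrite /g; case: asboolP.
  exists g => [x|]; first by rewrite /g; case: asboolP.
  exact/(lP _ _ _ gw).
apply/sigmaE; case: (Tc sigma) => [/KT'//|/KT /= nh].
by exfalso; apply: nh; apply/sigmaE; exists v.
Qed.

(** ** Counting formulas *)

(** The label [inr n] stands for the variable bound by the [n]-th quantifier counted
    from the inside. *)
Definition lift_label (A V : Type) (lab : V -> A + nat) (x : option V) : A + nat :=
  if x is Some y then
    match lab y with inl z => inl z | inr n => inr n.+1 end
  else inr 0.

Lemma lift_labelI A V (lab : V -> A + nat) :
  injective lab -> injective (lift_label lab).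
Proof.
move=> labI [x|] [y|] //=; last by case: (lab y).
  move=> e; congr Some; apply: labI; move: e.
  by case: (lab x) (lab y) => [a|m] [b|n] // [->].
by case: (lab x).
Qed.

Notation Node := GenTree.Node.
Notation Leaf := GenTree.Leaf.

Local Notation label A := ((Defs.fsym L + rsym L) + (A + nat))%type.

Fixpoint term_code A V (lab : V -> A + nat) (t : term L V) : GenTree.tree (label A) :=
  match t with
  | Var x => Node 0 [:: Leaf (inr (lab x))]
  | App f args => Node 1 (Leaf (inl (inl f)) ::
      [seq term_code lab (args i) | i <- enum 'I_(fsym_arity f)])
  end.

Fixpoint formula_code A V (lab : V -> A + nat) (phi : formula L V) :
    GenTree.tree (label A) :=
  match phi with
  | Bot => Node 0 [::]
  | Eq t u => Node 1 [:: term_code lab t; term_code lab u]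
  | Rel r args => Node 2 (Leaf (inl (inr r)) ::
      [seq term_code lab (args i) | i <- enum 'I_(rsym_arity r)])
  | Imp psi chi => Node 3 [:: formula_code lab psi; formula_code lab chi]
  | All psi => Node 4 [:: formula_code (lift_label lab) psi]
  end.

Lemma map_enumI (X : Type) k (f : 'I_k -> X) (g : 'I_k -> X) :
  [seq f i | i <- enum 'I_k] = [seq g i | i <- enum 'I_k] -> f =1 g.
Proof.
move=> e i; have : i \in enum 'I_k by rewrite mem_enum.
elim: (enum 'I_k) e => //= j js IH [e es]; rewrite inE => /orP[/eqP ->//|].
exact: IH.
Qed.

Lemma term_codeI A V (lab : V -> A + nat) : injective lab -> injective (term_code lab).
Proof.
move=> labI; elim=> [x|f args IH] [y|g args'] //=.
  by case=> /labI ->.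
case=> fg; rewrite -fg in args' * => /map_enumI e; congr App.
by apply: funext => i; exact/IH/e.
Qed.

Lemma formula_codeI A V (lab : V -> A + nat) :
  injective lab -> injective (formula_code lab).
Proof.
move=> + phi; elim: V / phi lab => V.
- by move=> lab labI [].
- by move=> t u lab labI [] //= t' u' [/(term_codeI labI) -> /(term_codeI labI) ->].
- move=> r args lab labI [] //= r' args' [rr]; rewrite -rr in args' * => /map_enumI e.
  by congr Rel; apply: funext => i; exact/(term_codeI labI)/e.
- by move=> psi IH1 chi IH2 lab labI [] //= psi' chi' [/IH1 -> // /IH2 -> //].
- by move=> psi IH lab labI [] //= psi' [/IH -> //]; exact: lift_labelI.
Qed.

Lemma injects_formula V Z :
  infinite Z -> injects (Defs.fsym L) Z -> injects (rsym L) Z -> injects V Z ->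
  injects (formula L V) Z.
Proof.
move=> Zinf fZ rZ VZ; apply: (@injects_trans _ (GenTree.tree (label V))).
  by exists (formula_code inl); apply: formula_codeI => x y [].
by apply: injects_tree => //; do !apply: injects_sum_into.
Qed.

(** A complete theory contains all valid sentences; hence it is infinite, and has at
    least as many elements as there are symbols in the language. *)
Lemma complete_taut (T : theory L) phi :
  complete T -> (forall M : structure L, sat (of_void M) phi) -> T phi.
Proof.
move=> [[M MT] Tc] taut; case: (Tc phi) => // /MT /=.
by move=> /(_ (taut M)).
Qed.

Lemma injects_theory (T : theory L) X (f : X -> formula L void) :
  complete T -> (forall x (M : structure L), sat (of_void M) (f x)) -> injective f ->
  injects X (set_type T).
Proof.
move=> Tc fT fI; exists (fun x => exist _ (f x) (mem_set (complete_taut Tc (fT x)))).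
by move=> x y [/fI].
Qed.

Lemma complete_infinite (T : theory L) : complete T -> infinite (set_type T).
Proof.
move=> Tc; pose f n : formula L void := Imp Bot (iter n (Imp Bot) Bot).
apply: (injects_theory (f := f)) => //; first by move=> n M [].
have fI : injective (fun n => iter n (Imp Bot) Bot : formula L void).
  elim=> [|m IH] [|n] //= [e]; congr S; exact: IH.
by move=> m n; rewrite /f => -[e]; exact: fI.
Qed.

Lemma complete_fsym (T : theory L) : complete T -> injects (Defs.fsym L) (set_type T).
Proof.
move=> Tc; pose t f : term L (option void) := App f (fun=> Var None).
apply: (injects_theory (f := fun f => All (Eq (t f) (t f)))) => //.
by move=> f g [].
Qed.

Lemma complete_rsym (T : theory L) : complete T -> injects (rsym L) (set_type T).
Proof.
move=> Tc; pose t r : formula L (option void) := Rel r (fun=> Var None).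
apply: (injects_theory (f := fun r => All (Imp (t r) (t r)))) => //; first by move=> r M a.
by move=> f g [].
Qed.

End FirstOrder.

(** * Formulas of the many-sorted language *)

Lemma injects_tagged Z (F : nat -> Type) :
  infinite Z -> (forall n, injects (F n) Z) -> injects {n : nat & F n} Z.
Proof.
move=> Zinf FZ; pose f n := sval (cid (FZ n)).
have fI n : injective (f n) := svalP (cid (FZ n)).
apply: (@injects_trans _ (nat * Z)); last exact/injects_prod_into/injects_refl.
exists (fun p => (tag p, f _ (tagged p))) => -[n x] [m y] /= [nm].
by subst m => /fI ->.
Qed.

Lemma injects_ord n Z : infinite Z -> injects 'I_n Z.
Proof. by apply: injects_trans; exists val; exact: val_inj. Qed.

Section ManySorted.
Variables (L : language) (M : structure L).
Notation sort := (eq_sort M).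
Notation ctxt := (sort -> Type).

Definition ext_map (V W : ctxt) (f : forall s, V s -> W s) s0 s
    (x : eq_ctx_ext V s0 s) : eq_ctx_ext W s0 s :=
  match x with NewVar => NewVar _ _ | OldVar s y => OldVar _ (f s y) end.

Fixpoint eq_trename (V W : ctxt) (f : forall s, V s -> W s) s (t : eq_term V s) :
    eq_term W s :=
  match t with
  | EqVar s x => EqVar (f s x)
  | EqApp g args => EqApp (fun i => eq_trename f (args i))
  | EqProj E args => EqProj (fun i => eq_trename f (args i))
  end.

Fixpoint eq_frename (V W : ctxt) (f : forall s, V s -> W s) (phi : eq_formula V) :
    eq_formula W :=
  match phi with
  | EqBot => EqBot _
  | EqEq s t u => EqEq (eq_trename f t) (eq_trename f u)
  | EqRel r args => EqRel (fun i => eq_trename f (args i))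
  | EqImp psi chi => EqImp (eq_frename f psi) (eq_frename f chi)
  | EqAll s psi => EqAll (eq_frename (@ext_map _ _ f s) psi)
  end.

Lemma eq_eval_trename (V W : ctxt) (f : forall s, V s -> W s) (v : eq_valuation W) s
    (t : eq_term V s) :
  eq_eval v (eq_trename f t) = eq_eval (fun s x => v s (f s x)) t.
Proof.
elim: t => //= [g args IH|E args IH].
  by congr finterp; exact: funext.
by congr imag_proj; exact: funext.
Qed.

Lemma eq_sat_frename (V W : ctxt) (f : forall s, V s -> W s) (v : eq_valuation W) phi :
  eq_sat v (eq_frename f phi) <-> eq_sat (fun s x => v s (f s x)) phi.
Proof.
elim: V / phi W f v => //= V.
- by move=> s t u W f v; rewrite !eq_eval_trename.
- move=> r args W f v; suff -> : (fun i => eq_eval v (eq_trename f (args i))) =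
    (fun i => eq_eval (fun s x => v s (f s x)) (args i)) by [].
  by apply: funext => i; rewrite eq_eval_trename.
- by move=> psi IH1 chi IH2 W f v; rewrite IH1 IH2.
- move=> s psi IH W f v.
  have e (a : eq_carrier s) : (fun s' x => eq_val_ext v a (ext_map f x)) =
      eq_val_ext (fun s x => v s (f s x)) a.
    apply: functional_extensionality_dep => s'.
    by apply: functional_extensionality_dep => -[].
  by split=> h a; have := h a; rewrite IH e.
Qed.

Notation var V := {s : sort & V s}.

Definition agree (V : ctxt) (l : seq (var V)) (v w : eq_valuation V) :=
  forall s (x : V s), In (existT _ s x) l -> v s x = w s x.

Lemma agree_cat (V : ctxt) (l m : seq (var V)) v w :
  agree (l ++ m) v w -> agree l v w /\ agree m v w.
Proof.
by move=> a; split=> s x xl; apply/a/List.in_or_app; [left|right].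
Qed.

Lemma agree_flatten (V : ctxt) k (l : 'I_k -> seq (var V)) v w i :
  agree (flatten [seq l j | j <- enum 'I_k]) v w -> agree (l i) v w.
Proof. by move=> a s x xl; apply/a/In_flatten_ord/xl. Qed.

Lemma eq_term_support (V : ctxt) s (t : eq_term V s) : exists l : seq (var V),
  forall v w, agree l v w -> eq_eval v t = eq_eval w t.
Proof.
elim: t => [s' x|g args /choice[l lP]|E args /choice[l lP]].
- by exists [:: existT _ s' x] => v w vw /=; apply: vw; left.
- exists (flatten [seq l j | j <- enum 'I_(fsym_arity g)]) => v w vw /=.
  by congr finterp; apply: funext => i; exact/lP/(agree_flatten vw).
- exists (flatten [seq l j | j <- enum 'I_(imag_dim E)]) => v w vw /=.
  by congr imag_proj; apply: funext => i; exact/lP/(agree_flatten vw).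
Qed.

Definition old_var (V : ctxt) s0 (z : var (eq_ctx_ext V s0)) : option (var V) :=
  match tagged z with NewVar => None | OldVar s x => Some (existT _ s x) end.

Lemma eq_formula_support (V : ctxt) (phi : eq_formula V) : exists l : seq (var V),
  forall v w, agree l v w -> eq_sat v phi <-> eq_sat w phi.
Proof.
elim: V / phi => V.
- by exists [::].
- move=> s t u; have [l lP] := eq_term_support t; have [m mP] := eq_term_support u.
  exists (l ++ m) => v w /agree_cat[vl vm] /=.
  by rewrite (lP _ _ vl) (mP _ _ vm).
- move=> r args; have /choice[l lP] := fun i => eq_term_support (args i).
  exists (flatten [seq l j | j <- enum 'I_(rsym_arity r)]) => v w vw /=.
  suff -> : (fun i => eq_eval v (args i)) = (fun i => eq_eval w (args i)) by [].
  by apply: funext => i; exact/lP/(agree_flatten vw).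
- move=> psi [l lP] chi [m mP]; exists (l ++ m) => v w /agree_cat[vl vm] /=.
  by rewrite (lP _ _ vl) (mP _ _ vm).
- move=> s0 psi [l lP]; exists (pmap (@old_var V s0) l) => v w vw /=.
  suff vw' (a : eq_carrier s0) : eq_sat (eq_val_ext v a) psi <-> eq_sat (eq_val_ext w a) psi.
    by split=> h a; apply/vw'.
  apply: lP => s x; case: x => //= s' x xl; apply: vw.
  exact: (In_pmap xl).
Qed.

(** ** Home formulas inside the many-sorted language *)

Fixpoint home_term (V : Type) (W : ctxt) (f : V -> W Home) (t : term L V) : eq_term W Home :=
  match t with
  | Var x => EqVar (f x)
  | App g args => EqApp (fun i => home_term f (args i))
  end.

Definition home_lift (V : Type) (W : ctxt) (f : V -> W Home) (x : option V) :
    eq_ctx_ext W Home Home :=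
  if x is Some y then OldVar _ (f y) else NewVar _ _.

Fixpoint home_formula (V : Type) (W : ctxt) (f : V -> W Home) (phi : formula L V) :
    eq_formula W :=
  match phi with
  | Bot => EqBot _
  | Eq t u => EqEq (home_term f t) (home_term f u)
  | Rel r args => EqRel (fun i => home_term f (args i))
  | Imp psi chi => EqImp (home_formula f psi) (home_formula f chi)
  | All psi => EqAll (s := Home) (home_formula (home_lift f) psi)
  end.

Lemma eq_eval_home (V : Type) (W : ctxt) (f : V -> W Home) (v : eq_valuation W) t :
  eq_eval v (home_term f t) = eval (M := M) (fun x => v Home (f x)) t.
Proof. by elim: t => //= g args IH; congr finterp; exact: funext. Qed.

Lemma eq_sat_home (V : Type) (W : ctxt) (f : V -> W Home) (v : eq_valuation W) phi :
  eq_sat v (home_formula f phi) <-> sat (M := M) (fun x => v Home (f x)) phi.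
Proof.
elim: V / phi W f v => //= V.
- by move=> t u W f v; rewrite !eq_eval_home.
- move=> r args W f v; suff -> : (fun i => eq_eval v (home_term f (args i))) =
    (fun i => eval (M := M) (fun x => v Home (f x)) (args i)) by [].
  by apply: funext => i; rewrite eq_eval_home.
- by move=> psi IH1 chi IH2 W f v; rewrite IH1 IH2.
- move=> psi IH W f v.
  have e (a : M) : (fun x => eq_val_ext v (s := Home) a (home_lift f x)) =
      oapp (fun x => v Home (f x)) a by apply: funext => -[].
  by split=> h a; have := h a; rewrite IH e.
Qed.

(** ** Counting many-sorted formulas *)

Notation Node := GenTree.Node.
Notation Leaf := GenTree.Leaf.
Local Notation label A := ((Defs.fsym L + rsym L) + (sort + (A + nat)))%type.

Definition labelling (V : ctxt) A := forall s, V s -> A + nat.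

Definition labelling_inj (V : ctxt) A (lab : labelling V A) :=
  forall s x s' x', lab s x = lab s' x' -> existT V s x = existT V s' x'.

Definition eq_lift_label (V : ctxt) A (lab : labelling V A) s0 :
    labelling (eq_ctx_ext V s0) A := fun s x =>
  match x with
  | NewVar => inr 0
  | OldVar s y => match lab s y with inl z => inl z | inr n => inr n.+1 end
  end.
Arguments eq_lift_label {V A} lab s0 [s] x.

Lemma eq_lift_labelI V A (lab : labelling V A) s0 :
  labelling_inj lab -> labelling_inj (eq_lift_label lab s0).
Proof.
move=> labI s [|s1 x] s' [|s2 y] //=; first by case: (lab s2 y).
  by case: (lab s1 x).
move=> e; have := labI s1 x s2 y; move: e.
case: (lab s1 x) (lab s2 y) => [a|m] [b|n] // [->] /(_ erefl) exy.
  exact: (f_equal (fun p : var V => existT (eq_ctx_ext V s0) (projT1 p) (OldVar _ (projT2 p))) exy).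
exact: (f_equal (fun p : var V => existT (eq_ctx_ext V s0) (projT1 p) (OldVar _ (projT2 p))) exy).
Qed.

Fixpoint eq_term_code (V : ctxt) A (lab : labelling V A) s (t : eq_term V s) :
    GenTree.tree (label A) :=
  match t with
  | EqVar s x => Node 0 [:: Leaf (inr (inr (lab s x)))]
  | EqApp f args => Node 1 (Leaf (inl (inl f)) ::
      [seq eq_term_code lab (args i) | i <- enum 'I_(fsym_arity f)])
  | EqProj E args => Node 2 (Leaf (inr (inl (Quot E))) ::
      [seq eq_term_code lab (args i) | i <- enum 'I_(imag_dim E)])
  end.

Fixpoint eq_formula_code (V : ctxt) A (lab : labelling V A) (phi : eq_formula V) :
    GenTree.tree (label A) :=
  match phi with
  | EqBot => Node 0 [::]
  | EqEq s t u => Node 1 [:: eq_term_code lab t; eq_term_code lab u]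
  | EqRel r args => Node 2 (Leaf (inl (inr r)) ::
      [seq eq_term_code lab (args i) | i <- enum 'I_(rsym_arity r)])
  | EqImp psi chi => Node 3 [:: eq_formula_code lab psi; eq_formula_code lab chi]
  | EqAll s psi => Node 4 [:: Leaf (inr (inl s)); eq_formula_code (eq_lift_label lab s) psi]
  end.

(** The code must also determine the sort of a term, whence the dependent pairs. *)
Lemma eq_term_codeI (V : ctxt) A (lab : labelling V A) : labelling_inj lab ->
  forall s t s' t', eq_term_code lab t = eq_term_code lab t' ->
  existT (eq_term V) s t = existT (eq_term V) s' t'.
Proof.
move=> labI s t; elim: t => [s1 x|f args IH|E args IH] s' [s2 y|f' args'|E' args'] //=.
- case=> /labI e.
  exact: (f_equal (fun p : var V => existT (eq_term V) (projT1 p) (EqVar (projT2 p))) e).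
- case=> ff; rewrite -ff in args' * => /map_enumI e.
  congr existT; congr EqApp; apply: funext => i.
  exact/inj_pair2/IH/e.
- case=> EE; rewrite -EE in args' * => /map_enumI e.
  congr existT; congr EqProj; apply: funext => i.
  exact/inj_pair2/IH/e.
Qed.

Lemma eq_formula_codeI (V : ctxt) A (lab : labelling V A) :
  labelling_inj lab -> injective (eq_formula_code lab).
Proof.
move=> + phi; elim: V / phi lab => V.
- by move=> lab labI [].
- move=> s t u lab labI [] //= s' t' u' [/(eq_term_codeI labI) et /(eq_term_codeI labI) eu].
  have ss : s = s' := f_equal (@projT1 _ _) et.
  by subst s'; rewrite (inj_pair2 _ _ _ _ _ et) (inj_pair2 _ _ _ _ _ eu).
- move=> r args lab labI [] //= r' args' [rr]; rewrite -rr in args' * => /map_enumI e.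
  by congr EqRel; apply: funext => i; exact/inj_pair2/(eq_term_codeI labI)/e.
- by move=> psi IH1 chi IH2 lab labI [] //= psi' chi' [/IH1 -> // /IH2 -> //].
- move=> s psi IH lab labI [] //= s' psi' [ss]; subst s' => /IH -> //.
  exact: eq_lift_labelI.
Qed.

Lemma injects_eq_sort Z :
  infinite Z -> injects (Defs.fsym L) Z -> injects (rsym L) Z -> injects sort Z.
Proof.
move=> Zinf fZ rZ.
apply: (@injects_trans _ (unit + {n : nat & formula L ('I_n + 'I_n)})).
  exists (fun s => match s with
    | Home => inl tt
    | Quot E => inr (existT (fun n => formula L ('I_n + 'I_n)) _ (imag_rel E)) end).
  move=> [|[n E EP]] [|[n' E' EP']] //= [nn]; subst n' => e.
  have EE := inj_pair2 _ _ _ _ _ e; subst E'; clear e.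
  by rewrite (Prop_irrelevance EP EP').
apply: injects_sum_into => //.
  by apply: injects_trans Zinf; exists (fun=> 0) => -[] [].
apply: injects_tagged => // n; apply: injects_formula => //.
by apply: injects_sum_into => //; exact: injects_ord.
Qed.

Lemma injects_eq_formula (V : ctxt) A (lab : forall s, V s -> A) Z :
  (forall s x s' x', lab s x = lab s' x' -> existT V s x = existT V s' x') ->
  infinite Z -> injects (Defs.fsym L) Z -> injects (rsym L) Z -> injects A Z ->
  injects (eq_formula V) Z.
Proof.
move=> labI Zinf fZ rZ AZ; apply: (@injects_trans _ (GenTree.tree (label A))).
  exists (eq_formula_code (fun s x => inl (lab s x))).
  by apply: eq_formula_codeI => s x s' x' [/labI].
apply: injects_tree => //; do 3?apply: injects_sum_into => //.
exact: injects_eq_sort.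
Qed.
End ManySorted.

(** * Ultrafilters *)

Lemma ultrafilter_of_base T (B : set (set T)) :
  B !=set0 -> (forall A A', B A -> B A' -> exists2 A'', B A'' & A'' `<=` A `&` A') ->
  (forall A, B A -> A !=set0) ->
  exists2 U : set_system T, UltraFilter U & B `<=` U.
Proof.
move=> B0 BI Bn0.
have FF : ProperFilter (filter_from B id).
  by apply: filter_from_proper => //; exact: filter_from_filter.
have [U [UU FU]] := ultraFilterLemma FF.
by exists U => // A BA; apply: FU; exists A.
Qed.

Lemma ultrafilter_pushforward T S (f : T -> S) (U : set_system T) :
  UltraFilter U -> UltraFilter (f @ U).
Proof.
move=> UU; have FF : ProperFilter (f @ U) by exact: fmap_proper_filter.
split=> // G GF UG; apply/seteqP; split=> // A GA.
case: (in_ultra_setVsetC (F := U) (f @^-1` A)) => // UA.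
have : G set0 by rewrite -(setICl A); apply: filterI GA; exact: UG.
by move/filter_not_empty.
Qed.

Section Ultra.
Variables (T : Type) (U : set_system T).
Context {UU : UltraFilter U}.

Lemma ultra_not A : ~ U A <-> U (~` A).
Proof.
split=> [nA|h hA]; first by case: (in_ultra_setVsetC A).
have : U set0 by rewrite -(setICl A); exact: filterI.
exact: filter_not_empty.
Qed.

Lemma ultra_forall_list S (l : seq S) (A : S -> set T) :
  (forall s, In s l -> U (A s)) -> U [set x | forall s, In s l -> A s x].
Proof.
elim: l => [|s l IH] h; first by apply: filterS filterT => x _ s [].
have h1 := h s (or_introl erefl); have h2 := IH (fun t tl => h t (or_intror tl)).
by apply: filterS (filterI h1 h2) => x [x1 x2] t [<-|/x2].
Qed.

(** A function with finitely many values has a limit along an ultrafilter. *)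
Lemma ultra_pick S (f : T -> S) (s : seq S) :
  U [set x | In (f x) s] -> exists a, U [set x | f x = a].
Proof.
elim: s => [h|a s IH h].
  have : U set0 by apply: filterS h => x [].
  by move=> /filter_not_empty.
case: (pselect (U [set x | f x = a])) => [Ua|/ultra_not nUa]; first by exists a.
apply: IH; apply: filterS (filterI h nUa) => x [/= [ax|//] nax].
by case: nax.
Qed.
End Ultra.

(** * Relations between elements and sequences *)

Section Configurations.
Variables (L : language) (M : structure L).
Variables (Mu : Type) (sigma : Mu -> eq_sort M) (I : set (eq_seq sigma)).
Notation X := (set_type I).

(** In a formula, a sequence variable [y] is present through its entries [(y, i)]. *)
Inductive ctx (V Y : Type) : eq_sort M -> Type :=
| HomeVar (v : V) : ctx V Y Home
| EntryVar (y : Y) (i : Mu) : ctx V Y (sigma i).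
Arguments HomeVar {V Y}.
Arguments EntryVar {V Y}.

Definition ctx_val V Y (b : V -> M) (e : Y -> X) : eq_valuation (ctx V Y) :=
  fun s x => match x in ctx _ _ s return eq_carrier s with
    | HomeVar v => b v
    | EntryVar y i => val (e y) i
    end.

Definition cfg_pred V Y := (V -> M) -> (Y -> X) -> Prop.

Definition definable V Y (P : cfg_pred V Y) :=
  exists phi : eq_formula (ctx V Y), forall b e, P b e <-> eq_sat (ctx_val b e) phi.

(** A semantic notion of support, by which it can be cut down to finite sets of
    variables without any renaming of formulas. *)
Definition depends V Y (K : set V) (K' : set Y) (P : cfg_pred V Y) :=
  forall b b' e e', (forall v, K v -> b v = b' v) -> (forall y, K' y -> e y = e' y) ->
  P b e -> P b' e'.

Lemma definable_ext V Y (P Q : cfg_pred V Y) :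
  (forall b e, P b e <-> Q b e) -> definable P -> definable Q.
Proof. by move=> PQ [phi h]; exists phi => b e; rewrite -PQ. Qed.

Lemma definable_imp V Y (P Q : cfg_pred V Y) : definable P -> definable Q ->
  definable (fun b e => P b e -> Q b e).
Proof.
by move=> [phi hP] [psi hQ]; exists (EqImp phi psi) => b e /=; rewrite hP hQ.
Qed.

Lemma definable_bot V Y : definable (fun (b : V -> M) (e : Y -> X) => False).
Proof. by exists (EqBot _). Qed.

Lemma definable_not V Y (P : cfg_pred V Y) : definable P -> definable (fun b e => ~ P b e).
Proof. by move=> dP; apply: definable_imp dP (definable_bot _ _). Qed.

Lemma definable_and V Y (P Q : cfg_pred V Y) : definable P -> definable Q ->
  definable (fun b e => P b e /\ Q b e).
Proof.
move=> dP dQ; apply: (definable_ext _ (definable_not (definable_imp dP (definable_not dQ)))).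
move=> b e; split=> [h|[h1 h2] h]; last exact: h.
by apply: contrapT => nh; apply: h => h1 h2; exact: nh.
Qed.

Lemma definable_iff V Y (P Q : cfg_pred V Y) : definable P -> definable Q ->
  definable (fun b e => P b e <-> Q b e).
Proof.
by move=> dP dQ; apply: definable_and; exact: definable_imp.
Qed.

Lemma definable_home V Y (phi : formula L V) :
  definable (fun b (e : Y -> X) => sat b phi).
Proof. by exists (home_formula HomeVar phi) => b e; rewrite eq_sat_home. Qed.

Definition ctx_map V W Y Z (f : V -> W) (g : Y -> Z) s (x : ctx V Y s) : ctx W Z s :=
  match x with HomeVar v => HomeVar (f v) | EntryVar y i => EntryVar (g y) i end.

Lemma definable_rename V W Y Z (f : V -> W) (g : Y -> Z) (P : cfg_pred V Y) :
  definable P -> definable (fun b e => P (b \o f) (e \o g)).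
Proof.
move=> [phi h]; exists (eq_frename (ctx_map f g) phi) => b e; rewrite h eq_sat_frename.
suff -> : (fun s x => ctx_val b e (ctx_map f g (s:=s) x)) = ctx_val (b \o f) (e \o g) by [].
apply: functional_extensionality_dep => s.
by apply: functional_extensionality_dep => -[].
Qed.

Definition unbind_ctx V Y s (x : ctx (option V) Y s) : eq_ctx_ext (ctx V Y) Home s :=
  match x with
  | HomeVar (Some v) => OldVar _ (HomeVar v)
  | HomeVar None => NewVar _ _
  | EntryVar y i => OldVar _ (EntryVar y i)
  end.

Lemma definable_all V Y (P : cfg_pred (option V) Y) :
  definable P -> definable (fun b e => forall a, P (oapp b a) e).
Proof.
move=> [phi h]; exists (EqAll (s := Home) (eq_frename (@unbind_ctx V Y) phi)) => b e /=.
have E (a : M) : (fun s x => eq_val_ext (ctx_val b e) (s := Home) a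
    (unbind_ctx (s:=s) x)) = ctx_val (oapp b a) e.
  apply: functional_extensionality_dep => s.
  by apply: functional_extensionality_dep => -[[]|].
by split=> H a; have := H a; rewrite h eq_sat_frename E.
Qed.

Lemma definable_ex V Y (P : cfg_pred (option V) Y) :
  definable P -> definable (fun b e => exists a, P (oapp b a) e).
Proof.
move=> dP; apply: (definable_ext _ (definable_not (definable_all (definable_not dP)))).
move=> b e; split=> [/existsNP[a /contrapT h]|[a h] /(_ a)//]; by exists a.
Qed.

Lemma definable_ex_upd V Y (P : cfg_pred V Y) x :
  definable P -> definable (fun b e => exists a, P (upd b x a) e).
Proof.
move=> /(definable_rename (bind x) id)/definable_ex; apply: definable_ext => b e.
by under eq_exists => a do rewrite oapp_bind.
Qed.

Lemma definable_ex_list V Y (P : cfg_pred V Y) (l : seq V) : definable P ->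
  definable (fun b e => exists2 b', (forall x, ~ In x l -> b' x = b x) & P b' e).
Proof.
move=> dP; elim: l => [|x l IH].
  apply: definable_ext dP => b e; split=> [h|[b' bb h]]; first by exists b.
  by have <- : b' = b by apply: funext => x; exact: bb.
apply: (definable_ext _ (definable_ex_upd x IH)) => b e.
split=> [[a [w wv h]]|[w wv h]].
  exists w => // y yn; rewrite wv => [|yl]; last by apply: yn; right.
  by rewrite upd_neq // => yx; apply: yn; left.
exists (w x), w => // y yl.
case: (pselect (y = x)) => [->|yx]; first by rewrite upd_same.
by rewrite upd_neq //; apply: wv => -[/esym|].
Qed.

Lemma definable_support V Y (P : cfg_pred V Y) : definable P ->
  exists l m, depends [set x | In x l] [set y | In y m] P.
Proof.
move=> [phi h]; have [k kP] := eq_formula_support phi.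
exists (pmap (fun z : {s & ctx V Y s} => match tagged z with HomeVar v => Some v | _ => None end) k).
exists (pmap (fun z : {s & ctx V Y s} => match tagged z with EntryVar y i => Some y | _ => None end) k).
move=> b b' e e' bb ee; rewrite !h.
apply: iffLR; apply: kP => s x; case: x => [v|y i] xk /=.
  by apply: bb; apply: (In_pmap xk).
by congr (val _ i); apply: ee; apply: (In_pmap xk).
Qed.

(** Pass from [(b, e)] to [(b', e')] through the assignment that agrees with the first
    on [K1] and [J1], and with the second elsewhere. *)
Lemma depends_inter V Y (K1 K2 : set V) (J1 J2 : set Y) (P : cfg_pred V Y) :
  depends K1 J1 P -> depends K2 J2 P -> depends (K1 `&` K2) (J1 `&` J2) P.
Proof.
move=> d1 d2 b b' e e' bb ee h.
pose c v := if `[< K1 v >] then b v else b' v.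
pose d y := if `[< J1 y >] then e y else e' y.
apply: (d2 c b' d e').
- by move=> v K2v; rewrite /c; case: asboolP => // K1v; exact: bb.
- by move=> y J2y; rewrite /d; case: asboolP => // J1y; exact: ee.
- by apply: d1 h => [v|y] h; rewrite /c /d; case: asboolP.
Qed.

Lemma depends_sub V Y (K K' : set V) (J J' : set Y) (P : cfg_pred V Y) :
  K `<=` K' -> J `<=` J' -> depends K J P -> depends K' J' P.
Proof. by move=> KK JJ d b b' e e' bb ee; apply: d => [v /KK/bb|y /JJ/ee]. Qed.

(** The finitely many variables on which a definable predicate depends may be
    taken inside any sets of variables on which it depends. *)
Lemma definable_support_in V Y (K : set V) (J : set Y) (P : cfg_pred V Y) :
  definable P -> depends K J P -> exists l m,
  [/\ forall x, In x l -> K x, forall y, In y m -> J y &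
      depends [set x | In x l] [set y | In y m] P].
Proof.
move=> /definable_support[l [m d1]] d2.
have [l' l'P] := list_filter K l; have [m' m'P] := list_filter J m.
exists l', m'; split=> [x /l'P[]//|y /m'P[]//|].
by apply: depends_sub (depends_inter d1 d2) => [x [xl Kx]|y [ym Jy]];
  [apply/l'P|apply/m'P].
Qed.

(** Only finitely many of the variables in [V] matter, so that they can be quantified. *)
Lemma definable_exV V Y (P : cfg_pred V Y) :
  definable P -> definable (fun (_ : void -> M) e => exists b, P b e).
Proof.
move=> dP; have [l [m d]] := definable_support dP.
have h := definable_all (definable_rename (fun=> None : option void) id
  (definable_ex_list l dP)).
apply: (definable_ext _ h) => b e; split=> [H|[c Pc] a].
  by have [a] := carrier_inhabited M; have [c _ Pc] := H a; exists c.
exists (fun x => if `[< In x l >] then c x else a) => [x|]; first by case: asboolP.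
by apply: d Pc => //= x xl; case: asboolP.
Qed.

Lemma definable_allV V Y (P : cfg_pred V Y) :
  definable P -> definable (fun (_ : void -> M) e => forall b, P b e).
Proof.
move=> dP; apply: (definable_ext _ (definable_not (definable_exV (definable_not dP)))).
move=> b e; split=> [H c|H [c]]; last exact.
by apply: contrapT => n; apply: H; exists c.
Qed.

Lemma definable_atmost V Y N (P : cfg_pred (option V) Y) :
  definable P -> definable (fun b e => atmost N (fun x => P (oapp b x) e)).
Proof.
elim: N V P => [|N IH] V P dP.
  apply: (definable_ext _ (definable_all (definable_not dP))) => b e.
  by rewrite atmost0.
pose Q : cfg_pred (option (option V)) Y := fun b e =>
  P (b \o (fun o => if o is Some v then Some (Some v) else None)) e /\
  ~ (b None = b (Some None)).
have dQ : definable Q.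
  apply: definable_and; first exact: (definable_rename _ id dP).
  apply: definable_not.
  exact: (definable_home Y (Eq (Var None) (Var (Some None)) : formula L (option (option V)))).
apply: (definable_ext _ (definable_ex (IH _ _ dQ))) => b e.
rewrite atmostS; last exact: carrier_inhabited.
have E (a x : M) : oapp (oapp b a) x \o
   (fun o => if o is Some v then Some (Some v) else None) = oapp b x.
  by apply: funext => -[].
by split=> -[a h]; exists a; move: h; apply: atmost_sub => x; rewrite /Q /= E.
Qed.

(** ** Indiscernibility *)

Hypothesis Iindisc : indiscernible_set I.
Hypothesis Xinf : infinite X.

Definition inj_on Y (K : set Y) (e : Y -> X) := forall y z, K y -> K z -> e y = e z -> y = z.

Lemma fresh_element (s : seq X) : exists x, ~ In x s.
Proof.
apply: contrapT => h; have {}h x : In x s by apply: contrapT => n; apply: h; exists x.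
have [i iI] := Xinf.
have : forall n, exists k : 'I_(size s), onth s k = Some (i n).
  move=> n; have [k ek] := In_nth_error (h (i n)).
  have ks : (k < size s)%N by rewrite ltnNge; apply/negP => /onth_default; rewrite ek.
  by exists (Ordinal ks).
move=> /choice[f fP].
have [m [n [mn fmn]]] := infinite_finType f (injects_refl nat).
by apply/mn/iI; have := fP n; rewrite -fmn fP => -[].
Qed.

Lemma list_enum Y (s : seq Y) : exists n (y : 'I_n -> Y),
  injective y /\ forall z, In z s <-> exists j, y j = z.
Proof.
elim: s => [|x s [n [y [yI ys]]]].
  by exists 0, (fun j : 'I_0 => False_rect Y (notF (ltn_ord j))); split=> [[]//|z]; split=> // -[[]].
case: (pselect (In x s)) => xs.
  exists n, y; split=> // z; rewrite -ys; split=> [[<-|]|] //; by right.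
exists n.+1, (fun j => if unlift ord0 j is Some k then y k else x); split.
  move=> j k; case: (unliftP ord0 j) (unliftP ord0 k) => [j' ->|->] [k' ->|->] //.
  - by move=> /yI ->.
  - by move=> e; case: xs; apply/ys; exists j'.
  - by move=> e; case: xs; apply/ys; exists k'.
move=> z /=; rewrite ys; split=> [[<-|[j <-]]|[j]].
- by exists ord0; rewrite unlift_none.
- by exists (lift ord0 j); rewrite liftK.
- by case: (unliftP ord0 j) => [j' _ <-|_ <-]; [right; exists j'|left].
Qed.

Definition seq_of_ctx n Y (g : Y -> 'I_n) s (x : ctx void Y s) : seq_ctx sigma n s :=
  match x with HomeVar v => of_void _ v | EntryVar y i => SeqVar sigma (g y) i end.

(** Sentences about sequences from [I] have a truth value that depends only on
    which sequences are equal. *)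
Lemma indiscernible Y (K : set Y) (P : cfg_pred void Y) b b' (e e' : Y -> X) :
  definable P -> depends setT K P -> inj_on K e -> inj_on K e' -> P b e -> P b' e'.
Proof.
move=> dP dK eI eI' Pe; have [l [m [_ mK dm]]] := definable_support_in dP dK.
have [n [y [yI ym]]] := list_enum m.
(* one more sequence serves as the value of all irrelevant variables *)
pose g z : 'I_n.+1 := if pselect (exists j, y j = z) is left h then
  lift ord0 (sval (cid h)) else ord0.
have gy z : In z m -> exists2 j, y j = z & g z = lift ord0 j.
  move=> /ym h; rewrite /g; case: pselect => // h'.
  by exists (sval (cid h')) => //; case: (cid h').
have ext (f : Y -> X) : inj_on K f ->
    exists h : 'I_n.+1 -> X, injective h /\ forall z, In z m -> h (g z) = f z.
  move=> fI; have [x xf] := fresh_element [seq f z | z <- m].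
  exists (fun j => if unlift ord0 j is Some k then f (y k) else x); split.
    have ymK j : K (y j) by apply/mK/ym; exists j.
    have yf j : In (f (y j)) [seq f z | z <- m].
      by apply: List.in_map; apply/ym; exists j.
    move=> j k; case: (unliftP ord0 j) (unliftP ord0 k) => [j' ->|->] [k' ->|->] //.
    - by move=> /fI /yI -> .
    - by move=> ex; case: xf; rewrite -ex.
    - by move=> ex; case: xf; rewrite ex.
  by move=> z /gy[j <- ->]; rewrite liftK.
have [phi phiP] := dP.
have trans (f : Y -> X) (h : 'I_n.+1 -> X) c : (forall z, In z m -> h (g z) = f z) ->
    P c f <-> eq_sat (seq_val (fun j => val (h j))) (eq_frename (seq_of_ctx g) phi).
  move=> hf; rewrite eq_sat_frename.
  have -> : (fun s x => seq_val (fun j => val (h j)) (seq_of_ctx g (s:=s) x)) =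
      ctx_val c (h \o g).
    apply: functional_extensionality_dep => s.
    by apply: functional_extensionality_dep => -[[]|].
  by rewrite -phiP; split; apply: dm => // z zm /=; rewrite hf.
have [h [hI he]] := ext _ eI; have [h' [hI' he']] := ext _ eI'.
rewrite (trans e' h' b' he').
have vI (k : 'I_n.+1 -> X) : injective k -> injective (fun j => val (k j)).
  by move=> kI i j /val_inj/kI.
apply/(Iindisc (vI _ hI) (vI _ hI')) => [j|j|]; [exact: set_mem (valP _)..|].
by rewrite -(trans e h b he).
Qed.
Lemma definable_true V Y : definable ((fun _ _ => True) : cfg_pred V Y).
Proof.
by apply: (definable_ext _ (definable_not (definable_bot V Y))) => b e; split=> // _ [].
Qed.

Lemma definable_forall_list V Y T (l : seq T) (P : T -> cfg_pred V Y) :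
  (forall t, In t l -> definable (P t)) ->
  definable ((fun b e => forall t, In t l -> P t b e) : cfg_pred V Y).
Proof.
elim: l => [|t l IH] dP; first by apply: (definable_ext _ (definable_true _ _)) => b e; split.
have d1 : definable (P t) by apply: dP; left.
have d2 := IH (fun u ul => dP u (or_intror ul)).
apply: (definable_ext _ (definable_and d1 d2)) => b e; split=> [[h1 h2] u [<-|ul]//|h].
  exact: h2.
by split=> [|u ul]; apply: h; [left|right].
Qed.

Definition defset Y (J : set Y) (S : (Y -> X) -> M -> Prop) :=
  definable ((fun b e => S e (b tt)) : cfg_pred unit Y) /\
  forall e e', (forall y, J y -> e y = e' y) -> forall x, S e x -> S e' x.

Lemma defset_sub Y (J J' : set Y) S : J `<=` J' -> defset J S -> defset J' S.
Proof. by move=> JJ [dS SJ]; split=> // e e' ee; apply: SJ => y /JJ/ee. Qed.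

Lemma defset_at Y (J : set Y) S V (v : V) : defset J S ->
  definable ((fun b e => S e (b v)) : cfg_pred V Y) /\
  depends [set v] J ((fun b e => S e (b v)) : cfg_pred V Y).
Proof.
move=> [dS SJ]; split; first exact: (definable_rename (fun=> v) id dS).
by move=> b b' e e' /(_ v erefl) -> ee; exact: SJ.
Qed.

Lemma defset_atmost Y (J : set Y) S V N : defset J S ->
  definable ((fun b e => atmost N (S e)) : cfg_pred V Y) /\
  depends set0 J ((fun b e => atmost N (S e)) : cfg_pred V Y).
Proof.
move=> [dS SJ]; split.
  have d := definable_rename (fun=> None : option V) id dS.
  exact: (definable_atmost N d).
by move=> b b' e e' _ ee; apply: atmost_sub; apply: SJ => y Jy; rewrite ee.
Qed.

(** Over a set of elements algebraic over some sequences of an indiscernible set,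
    the remaining sequences are still indiscernible.  Among infinitely many
    disjoint blocks of remaining sequences, two have the same relations to the
    finitely many possible values of the algebraic elements; that they do is a
    property of these two blocks which all pairs of disjoint blocks share. *)
Lemma indiscernible_over_algebraic V Y (K : set V) (J : set Y) b (e : Y -> X)
    (P : cfg_pred V (Y + nat)) (h h' : nat -> X) :
  inj_on J e ->
  (forall v, K v -> exists S N, [/\ defset J S, S e (b v) & atmost N (S e)]) ->
  definable P -> depends K [set z | if z is inl y then J y else True] P ->
  injective h -> injective h' ->
  (forall y n, J y -> h n <> e y) -> (forall y n, J y -> h' n <> e y) ->
  P b (sum_val e h) -> P b (sum_val e h').
Proof.
move=> eI Kalg dP dKJ hI hI' he he'.
have [l [m [lK mJ dlm]]] := definable_support_in dP dKJ.
have [k kP] := bounded_list m.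
have /choice[S SP] : forall v, exists S, K v -> exists N,
    [/\ defset J S, S e (b v) & atmost N (S e)].
  move=> v; case: (pselect (K v)) => [/Kalg[S SP]|nK]; first by exists S.
  by exists (fun _ _ => True).
pose swap1 (z : Y + nat) : Y + (nat + nat) :=
  match z with inl y => inl y | inr i => inr (inl i) end.
pose swap2 (z : Y + nat) : Y + (nat + nat) :=
  match z with inl y => inl y | inr i => inr (inr i) end.
(* two blocks have the same relation [P] to all candidates for the values of the
   variables in [l] *)
pose Theta : cfg_pred void (Y + (nat + nat)) := fun _ f => forall c : V -> M,
  (forall v, In v l -> S v (f \o inl) (c v)) -> (P c (f \o swap1) <-> P c (f \o swap2)).
have dTheta : definable Theta.
  pose Q : cfg_pred V (Y + (nat + nat)) := fun c f =>
    (forall v, In v l -> S v (f \o inl) (c v)) -> (P c (f \o swap1) <-> P c (f \o swap2)).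
  apply: (definable_allV (P := Q)); apply: definable_imp.
    apply: definable_forall_list => v /lK/SP[N [[dS _] _ _]].
    exact: (definable_rename (fun=> v) inl dS).
  by apply: definable_iff; exact: (definable_rename id _ dP).
pose D : set (Y + (nat + nat)) := fun z =>
  match z with inl y => J y | inr (inl i) => (i < k)%N | inr (inr i) => (i < k)%N end.
have depTheta : depends setT D Theta.
  move=> c c' f f' _ ff H a aS.
  have E1 : P a (f \o swap1) <-> P a (f' \o swap1).
    by split; apply: dlm => // -[y ym|i im] /=; rewrite ff //=; by
      [exact: (mJ _ ym)|exact: kP].
  have E2 : P a (f \o swap2) <-> P a (f' \o swap2).
    by split; apply: dlm => // -[y ym|i im] /=; rewrite ff //=; by
      [exact: (mJ _ ym)|exact: kP].
  rewrite -E1 -E2; apply: H => v vl.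
  have [N [[_ SJ] _ _]] := SP v (lK _ vl).
  by apply: SJ (aS v vl) => y Jy /=; rewrite ff.
pose two (g g' : nat -> X) : Y + (nat + nat) -> X := sum_val e (sum_val g g').
have two1 g g' : two g g' \o swap1 = sum_val e g by apply: funext => -[].
have two2 g g' : two g g' \o swap2 = sum_val e g' by apply: funext => -[].
pose away (g : nat -> X) := forall y n, J y -> g n <> e y.
have twoI g g' : injective g -> injective g' -> away g -> away g' ->
    (forall i j, (i < k)%N -> (j < k)%N -> g i <> g' j) -> inj_on D (two g g').
  move=> gI gI' ga ga' gg [y|[i|i]] [z|[j|j]] //= Dy Dz.
  - by move=> /eI -> .
  - by move=> /esym /ga.
  - by move=> /esym /ga'.
  - by move=> /ga.
  - by move=> /gI ->.
  - by move=> /gg; case.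
  - by move=> /ga'.
  - by move=> /esym /gg; case.
  - by move=> /gI' ->.
have [r rP] := tail_avoids ([seq h i | i <- iota 0 k] ++ [seq h' i | i <- iota 0 k]) hI.
have In_iota (g : nat -> X) i : (i < k)%N -> In (g i) [seq g i | i <- iota 0 k].
  by move=> ik; apply/List.in_map/mem_In; rewrite mem_iota.
(* only the first [k] entries of a block matter, and these are disjoint from those
   of the other blocks, of [h] and of [h'] *)
pose block n i := h (r + (n * k + i)).
have blockI n : injective (block n) by move=> i j /hI /addnI /addnI.
have blocka n : away (block n) by move=> y i; exact: he.
have [B BP] := @finite_choices V M (fun v => S v e) l b
  (fun v vl => let: ex_intro N (And3 _ _ SN) := SP v (lK _ vl) in ex_intro _ N SN).
(* the truth values of [P] for the [n]-th block *)
pose tv n : {ffun 'I_(size B) -> bool} :=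
  [ffun i : 'I_(size B) => `[< P (nth b B i) (sum_val e (block n)) >]].
have [n [n' [nn tvn]]] := infinite_finType tv (injects_refl nat).
have Th0 : Theta (of_void M) (two (block n) (block n')).
  move=> c cS; rewrite two1 two2.
  have [|c' c'B c'c] := BP c; first exact: cS.
  have E f : P c f <-> P c' f by split; apply: dlm => // v vl; rewrite c'c.
  have [i iB ci] := In_nth_ex b c'B.
  have := congr1 (fun t : {ffun 'I_(size B) -> bool} => t (Ordinal iB)) tvn.
  by rewrite !ffunE /= ci => e1; rewrite !E; exact: asbool_eq_equiv e1.
have Thall g g' : injective g -> injective g' -> away g -> away g' ->
    (forall i j, (i < k)%N -> (j < k)%N -> g i <> g' j) ->
    P b (sum_val e g) <-> P b (sum_val e g').
  move=> gI gI' ga ga' gg; rewrite -(two1 g g') -(two2 g g').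
  apply: (indiscernible (of_void M) dTheta depTheta _
    (twoI _ _ gI gI' ga ga' gg) Th0).
    apply: twoI => // i j ik jk /hI/addnI e1; apply: nn.
    have k0 : (0 < k)%N := leq_ltn_trans (leq0n _) ik.
    by have := congr1 (fun q => q %/ k) e1; rewrite !divnMDl // !divn_small // !addn0.
  by move=> v /lK/SP[N []].
have h0 g i j : (i < k)%N -> (forall n, ~ In (h (r + n)) [seq g i | i <- iota 0 k]) ->
    g i <> block 0 j.
  by move=> ik gP e1; apply: (gP (0 * k + j)); rewrite -[h _]e1; exact: In_iota.
have P1 : P b (sum_val e h) <-> P b (sum_val e (block 0)).
  apply: Thall => // i j ik _; apply: h0 => // a aI; apply: (rP a).
  by rewrite In_cat; left.
have P2 : P b (sum_val e h') <-> P b (sum_val e (block 0)).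
  apply: Thall => // i j ik _; apply: h0 => // a aI; apply: (rP a).
  by rewrite In_cat; right.
by rewrite P1 P2.
Qed.
(** An ultrafilter [U] on the assignments to the variables in [V] and [Y] serves as a
    complete type in these variables, with the truth predicate [ae U]. *)
Definition cfg V Y : Type := ((V -> M) * (Y -> X))%type.

Definition ae V Y (U : set_system (cfg V Y)) (P : cfg_pred V Y) : Prop :=
  U [set w | P w.1 w.2].

Definition generic V Y (U : set_system (cfg V Y)) :=
  forall y z, y <> z -> ae U (fun b e => e y <> e z).

(** The bound [N] is uniform, so that it carries over to all realizations of the type. *)
Definition algebraic V Y (U : set_system (cfg V Y)) (J : set Y) (v : V) :=
  exists S N, defset J S /\ ae U (fun b e => S e (b v) /\ atmost N (S e)).

Lemma generic_inj_on V Y (U : set_system (cfg V Y)) (m : seq Y) :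
  UltraFilter U -> generic U -> ae U (fun b e => inj_on [set y | In y m] e).
Proof.
move=> UU Ug; rewrite /ae.
have h := @ultra_forall_list _ U UU _ (List.list_prod m m)
  (fun p => [set w | p.1 <> p.2 -> w.2 p.1 <> w.2 p.2]).
apply: filterS (h _) => [w wI y z ym zm eyz|[y z] _ /=].
  apply: contrapT => yz; apply: (wI (y, z)) => //; exact/List.in_prod.
case: (pselect (y = z)) => [yz|yz]; first by apply: filterS filterT => w _ /(_ yz).
by apply: filterS (Ug _ _ yz) => w wyz.
Qed.

(** A statement about finitely many sequences which holds in [U] holds for some distinct
    sequences, hence for any distinct sequences. *)
Lemma ae_sentence V Y (U : set_system (cfg V Y)) (J : set Y) (Q : cfg_pred void Y) e :
  UltraFilter U -> generic U -> definable Q -> depends setT J Q ->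
  ae U (fun b e' => Q (of_void M) e') -> inj_on J e -> Q (of_void M) e.
Proof.
move=> UU Ug dQ dJ UQ eI; have [l [m [_ mJ dm]]] := definable_support_in dQ dJ.
have [[b e'] [/= Qe' eI']] := filter_ex (filterI UQ (generic_inj_on m UU Ug)).
apply: (indiscernible (of_void M) dQ _ eI' _ Qe').
  exact: depends_sub dm.
by move=> y z /mJ Jy /mJ; exact: eI.
Qed.

(** A type of elements algebraic over some generic sequences is realized over any
    other choice of distinct sequences: the algebraic elements have finitely
    many candidates each, so this is compactness in a product of finite sets,
    here in the form of a limit along an ultrafilter. *)
Lemma realize_algebraic V Y (U : set_system (cfg V Y)) (K : set V) (J : set Y) e :
  UltraFilter U -> generic U -> (forall v, K v -> algebraic U J v) -> inj_on J e ->
  exists b, forall P, definable P -> depends K J P -> ae U P -> P b e.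
Proof.
move=> UU Ug Kalg eI.
(* the limit [b] is taken along an ultrafilter of approximate realizations *)
pose B : set (set (V -> M)) := [set A | exists P : cfg_pred V Y,
  [/\ definable P, depends K J P, ae U P & A = [set b | P b e]]].
have [G GU BG] : exists2 G : set_system (V -> M), UltraFilter G & B `<=` G.
  apply: ultrafilter_of_base.
  - exists setT; exists (fun _ _ => True); split=> //; first exact: definable_true.
    exact: filterT.
  - move=> _ _ [P [dP DP UP ->]] [Q [dQ DQ UQ ->]].
    exists [set b | P b e /\ Q b e] => //.
    exists (fun b e => P b e /\ Q b e); split=> //.
    + exact: definable_and.
    + by move=> b b' f f' bb ff [/(DP _ _ _ _ bb ff)Pb /(DQ _ _ _ _ bb ff)Qb].
    + exact: filterI UP UQ.
  - move=> _ [P [dP DP UP ->]].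
    apply: (@ae_sentence V Y U J (fun _ e => exists b, P b e)) => //.
    + exact: definable_exV.
    + move=> _ _ f f' _ ff [b Pb]; exists b; exact: DP Pb.
    + by apply: filterS UP => -[b f] /= Pb; exists b.
have Kfin v : K v -> exists a, G [set b | b v = a].
  move=> Kv; have [S [N [dS US]]] := Kalg v Kv.
  have [dSv DSv] := defset_at v dS.
  have GS : G [set b | S e (b v)].
    apply: BG; exists (fun b e => S e (b v)); split=> //.
      by apply: depends_sub DSv => // _ ->.
    by apply: filterS US => w [].
  have [s _ sS] : atmost N (S e).
    have [dN DN] := defset_atmost void N dS.
    apply: (@ae_sentence V Y U J (fun _ e => atmost N (S e))) => //.
      exact: depends_sub DN.
    by apply: filterS US => w [].
  by apply: (@ultra_pick _ G GU _ _ s); apply: filterS GS => b /sS.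
have [a0] := carrier_inhabited M.
have /choice[b bP] : forall v, exists a, K v -> G [set b | b v = a].
  move=> v; case: (pselect (K v)) => [/Kfin[a aP]|nK]; first by exists a.
  by exists a0.
exists b => P dP DP UP; have [l [m [lK mJ dlm]]] := definable_support_in dP DP.
have GP : G [set b | P b e] by apply: BG; exists P.
have Gl := @ultra_forall_list _ G GU _ l (fun v => [set c | c v = b v])
  (fun v vl => bP v (lK v vl)).
have [c [Pc cb]] := filter_ex (filterI GP Gl).
exact: dlm Pc.
Qed.
End Configurations.

(** * Realizing elements by algebraic ones *)

Section CompleteTypes.
Variables (L : language) (N : structure L) (A : set N) (n : nat).
Variable p : set (formula L ('I_n + A)).
Hypothesis pc : complete_type p.

Lemma type_sat (l : seq (formula L ('I_n + A))) : (forall phi, In phi l -> p phi) ->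
  exists b, forall phi, In phi l -> sat_over b phi.
Proof.
move=> lp; have [|b bP] := proj2 pc [set phi | In phi l] _ lp; last by exists b.
elim: l {lp} => [|phi l IH]; first by apply: sub_finite_set (finite_set0 _) => x [].
apply: (sub_finite_set (B := [set phi] `|` [set x | In x l])).
  by move=> x [->|xl]; [left|right].
by rewrite finite_setU; split=> //; exact: finite_set1.
Qed.

Lemma type_and phi psi : p phi -> p psi -> p (And phi psi).
Proof.
move=> pp ps; case: (proj1 pc (And phi psi)) => // pn.
have [|b bP] := @type_sat [:: phi; psi; Neg (And phi psi)].
  by move=> x [<-//|[<-//|[<-//|[]]]].
have : sat_over b (Neg (And phi psi)) by apply: bP; right; right; left.
by case; apply/satAE; split; apply: bP; [left|right; left].
Qed.

Lemma type_nonempty : exists phi, p phi.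
Proof. by case: (proj1 pc Bot); [exists Bot|exists (Neg Bot)]. Qed.
End CompleteTypes.

Section HomeDefinable.
Variables (L : language) (M : structure L).

Definition home_definable V (P : (V -> M) -> Prop) :=
  exists phi : formula L V, forall b, P b <-> sat b phi.

Definition home_depends V (K : set V) (P : (V -> M) -> Prop) :=
  forall b b', (forall v, K v -> b v = b' v) -> P b -> P b'.

Lemma home_definable_ex V (P : M -> (V -> M) -> Prop) (phi : formula L (option V)) :
  (forall a b, P a b <-> sat (oapp b a) phi) -> home_definable (fun b => exists a, P a b).
Proof.
move=> h; exists (Neg (All (Neg phi))) => b /=; split=> [[a Pa] /(_ a)|H].
  by apply; apply/h.
by apply: contrapT => n; apply: H => a /h Pa; apply: n; exists a.
Qed.

Lemma And_list V (l : seq (formula L V)) : exists phi : formula L V,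
  forall (K : structure L) (b : V -> K), sat b phi <-> forall theta, In theta l -> sat b theta.
Proof.
elim: l => [|theta l [phi h]].
  by exists (Imp Bot Bot) => b; split=> // _ [].
exists (And theta phi) => K b; rewrite satAE h; split=> [[h1 h2] x [<-//|]|H].
  exact: h2.
by split=> [|x xl]; apply: H; [left|right].
Qed.

Lemma home_support V (K : set V) (P : (V -> M) -> Prop) :
  home_definable P -> home_depends K P -> exists2 l : seq V,
    forall v, In v l -> K v & home_depends [set v | In v l] P.
Proof.
move=> [phi phiP] PK; have [s sP] := formula_support phi.
have [l lP] := list_filter K s; exists l => [v /lP[]//|b b' bb Pb].
pose c v := if `[< K v >] then b v else b' v.
have /phiP Pc : P c by apply: PK Pb => v Kv; rewrite /c; case: asboolP.
apply/phiP; apply: (proj1 (sP M c b' _)) Pc => v vs; rewrite /c; case: asboolP => // Kv.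
exact/bb/lP.
Qed.
End HomeDefinable.

Section AlgebraicOverIndiscernibles.
Variables (L : language) (M : structure L).
Variables (Mu : Type) (sigma : Mu -> eq_sort M) (I : set (eq_seq sigma)).
Variable Tau : Type.
Notation X := (set_type I).
Notation cfg_pred := (cfg_pred I).
Hypothesis Iindisc : indiscernible_set I.
Hypothesis Tinf : infinite Tau.
Hypothesis fT : injects (Defs.fsym L) Tau.
Hypothesis rT : injects (rsym L) Tau.
Hypothesis muT : injects Mu Tau.
Hypothesis Mbig : ~ injects M Tau.
Hypothesis Msat : forall A : set M, injects A Tau ->
  forall p : set (formula L ('I_1 + A)), complete_type p ->
  exists b : 'I_1 -> M, p `<=` sat_over b.
Hypothesis Iacl : forall b : M, acl_eq (seq_entries I) (s := Home) b.

Lemma injects_form V Y Z : infinite Z -> injects Tau Z -> injects V Z -> injects Y Z ->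
  injects (eq_formula (ctx sigma V Y)) Z.
Proof.
move=> Zinf TZ VZ YZ.
pose lab s (x : ctx sigma V Y s) : V + Y * Mu :=
  match x with HomeVar v => inl v | EntryVar y i => inr (y, i) end.
apply: (@injects_eq_formula _ _ _ (V + Y * Mu)%type lab) => //.
- move=> s x s' x' /=; case: x => [v|y i]; case: x' => [v'|y' i'] //=.
    by case=> ->.
  by case=> -> ->.
- exact: injects_trans TZ.
- exact: injects_trans TZ.
- apply: injects_sum_into => //; apply: injects_prod_into => //.
  exact: injects_trans TZ.
Qed.

(** The parameters of an algebraic formula, which are imaginaries occurring in sequences
    of [I], become entries of sequence variables; these variables range over [X] itself,
    with the identity as assignment. *)
Lemma algebraic_in_X (a : M) : exists (phi : eq_formula (ctx sigma unit X)) (s : seq M),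
  eq_sat (ctx_val (fun=> a) id) phi /\
  forall x, eq_sat (ctx_val (fun=> x) id) phi -> In x s.
Proof.
have [phi /= [phia /finite_set_list[s sP]]] := Iacl a.
have entry t (x : eq_carrier t) : seq_entries I x -> exists c : ctx sigma unit X t,
    forall b, ctx_val b id c = x.
  move=> [e i Ie].
  by exists (@EntryVar _ _ _ sigma unit X (exist _ e (mem_set Ie)) i).
pose c t (x : seq_entries I (s:=t)) : ctx sigma unit X t :=
  sval (cid (entry t (val x) (set_mem (valP x)))).
have cP t x b : ctx_val b id (c t x) = val x.
  by rewrite /c; case: cid => /= d ->.
pose g t (x : eq_ctx_ext (fun s' => seq_entries I (s:=s')) Home t) : ctx sigma unit X t :=
  match x with NewVar => @HomeVar _ _ _ sigma unit X tt | OldVar t y => c t y end.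
have gP x : eq_sat (ctx_val (fun=> x) id) (eq_frename g phi) <->
    eq_sat (eq_val_ext (fun s' (a : seq_entries I (s:=s')) => val a) (s := Home) x) phi.
  rewrite eq_sat_frename.
  have -> : (fun s0 x0 => ctx_val (fun=> x) id (g s0 x0)) =
      eq_val_ext (fun s' (a : seq_entries I (s:=s')) => val a) (s := Home) x.
    apply: functional_extensionality_dep => t.
    by apply: functional_extensionality_dep => -[|t' y] //=; exact: cP.
  by [].
exists (eq_frename g phi), s; split=> [|x]; first exact/gP.
by move=> /gP/sP.
Qed.

(** An element is determined by an algebraic formula and its place in the list of
    solutions; if [X] were small, there would be [Tau]-many such pairs. *)
Lemma X_big : ~ injects X Tau.
Proof.
move=> XT; apply: Mbig.
apply: (@injects_trans _ (eq_formula (ctx sigma unit X) * nat)); last first.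
  apply: injects_prod_into => //; apply: injects_form => //; first exact: injects_refl.
  by apply: injects_trans Tinf; exists (fun=> 0) => -[] [].
pose good (phi : eq_formula (ctx sigma unit X)) (s : seq M) :=
  forall x, eq_sat (ctx_val (fun=> x) id) phi -> In x s.
have /choice[S SP] : forall phi, exists s, (exists s', good phi s') -> good phi s.
  move=> phi; case: (pselect (exists s', good phi s')) => [[s sP]|n]; first by exists s.
  by exists [::].
apply: (injects_rel (R := fun a p => onth (S p.1) p.2 = Some a)).
  move=> a; have [phi [s [phia sP]]] := algebraic_in_X a.
  have := SP phi (ex_intro _ s sP) a phia.
  by move=> h; have [n an] := In_nth_error h; exists (phi, n).
by move=> a b p /= -> [].
Qed.

Lemma Tau_X : injects Tau X.
Proof. by case: (injects_total X Tau) => // /X_big. Qed.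

Lemma X_infinite : infinite X.
Proof. exact: injects_trans Tau_X. Qed.

(** The home type of [v0] over [K], transported to the elements [b v], is a type over
    at most [Tau]-many parameters, and thus realized by saturation. *)
Lemma realize_home V (U : set_system (V -> M)) (K : set V) v0 b :
  UltraFilter U -> injects K Tau -> ~ K v0 ->
  (forall P, home_definable P -> home_depends K P -> U P -> P b) ->
  exists c, forall P, home_definable P -> home_depends (K `|` [set v0]) P -> U P ->
    P (upd b v0 c).
Proof.
move=> UU KT Kv0 bU.
pose A : set M := [set a | exists2 v, K v & b v = a].
have /choice[var varP] : forall a : A, exists v, K v /\ b v = val a.
  by move=> [a aA]; have [v Kv bv] := set_mem aA; exists v.
have AT : injects A Tau.
  apply: injects_trans KT.
  exists (fun a => exist _ (var a) (mem_set (proj1 (varP a))) : K) => a a' [e].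
  by apply: val_inj; rewrite -(proj2 (varP a)) e (proj2 (varP a')).
pose ev (c : V -> M) := sum_val (fun _ : 'I_1 => c v0) (fun a : A => c (var a)).
pose p : set (formula L ('I_1 + A)) := [set theta | U [set c | sat (ev c) theta]].
have pc : complete_type p.
  split=> [theta|F /finite_set_list[l lF] Fp]; first exact: in_ultra_setVsetC.
  have [l' l'P] : exists l' : seq (formula L ('I_1 + A)),
      (forall x, F x -> In x l') /\ (forall x, In x l' -> F x).
    have [t tP] := list_filter F l.
    by exists t; split=> x; rewrite tP; [move=> Fx; split=> //; exact: lF|case].
  have [phi phiP] := And_list l'.
  pose g (z : 'I_1 + A) : option V := match z with inl _ => None | inr a => Some (var a) end.
  pose P (c : V -> M) := exists x, sat (sum_val (fun _ : 'I_1 => x) (fun a : A => c (var a))) phi.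
  have gE (c : V -> M) x : oapp c x \o g = sum_val (fun _ : 'I_1 => x) (fun a : A => c (var a)).
    by apply: funext => -[].
  have [x xP] : P b.
    apply: bU.
    - apply: (home_definable_ex (phi := frename g phi)) => x c.
      by rewrite sat_frename gE.
    - move=> c c' cc [x h]; exists x; suff <- : (fun a : A => c (var a)) =
        (fun a : A => c' (var a)) by [].
      by apply: funext => a; apply: cc; case: (varP a).
    - have h := @ultra_forall_list _ U UU _ l' (fun theta => [set c | sat (ev c) theta])
        (fun theta thl => Fp _ (proj2 l'P _ thl)).
      by apply: filterS h => c h; exists (c v0); exact/phiP.
  exists (fun=> x) => theta Ft; move/phiP: xP => /(_ theta (proj1 l'P _ Ft)).
  suff -> : (fun a : A => b (var a)) = (fun a : A => val a) by [].
  by apply: funext => a; case: (varP a).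
have [c cp] := Msat AT pc.
exists (c ord0) => P [phi phiP] PK UP.
pose f v : 'I_1 + A := if pselect (K v) is left Kv then
  inr (exist _ (b v) (mem_set (ex_intro2 _ _ v Kv erefl))) else inl ord0.
have [l lK dl] := home_support (ex_intro _ phi phiP) PK.
have UE : U [set d | forall v, In v l -> K v -> d v = sum_val (fun _ : 'I_1 => d v0)
    (fun a : A => d (var a)) (f v)].
  apply: (@ultra_forall_list _ U UU _ l (fun v => [set d | K v -> d v = _ (f v)])) => v vl.
  case: (pselect (K v)) => Kv; last by apply: filterS filterT => d _ /Kv.
  apply: contrapT => /(proj1 (ultra_not _)); rewrite /f; case: pselect => // Kv' H.
  set a : A := exist _ _ _ in H.
  have : b v <> b (var a).
    apply: (bU (fun d => d v <> d (var a))).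
    - by exists (Neg (Eq (Var v) (Var (var a)))).
    - by move=> d d' dd; rewrite !dd //; case: (varP a).
    - by apply: filterS H => d /= n e; apply: n.
  by have [_ ->] := varP a.
have : p (frename f phi).
  apply: filterS (filterI UE UP) => d [dE Pd] /=.
  rewrite sat_frename -phiP; apply: (dl d) => // v vl /=.
  case: (lK v vl) => [Kv|->]; first exact: dE.
  by rewrite /f; case: pselect.
move=> /cp; rewrite /sat_over /= sat_frename -phiP; apply: PK => v /=.
rewrite /f; case: pselect => [Kv _|nK [//|->]] /=; last by rewrite upd_same.
by rewrite upd_neq // => vv; apply: Kv0; rewrite -vv.
Qed.

Lemma algebraic_mono V Y (U : set_system (cfg I V Y)) (J J' : set Y) v :
  J `<=` J' -> algebraic U J v -> algebraic U J' v.
Proof.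
by move=> JJ [S [N [dS h]]]; exists S, N; split=> //; exact: defset_sub dS.
Qed.

Lemma algebraic_finite V Y (U : set_system (cfg I V Y)) (J : set Y) v :
  algebraic U J v ->
  exists2 m : seq Y, (forall y, In y m -> J y) & algebraic U [set y | In y m] v.
Proof.
move=> [S [N [[dS SJ] US]]].
have [|l [m [_ mJ dlm]]] := @definable_support_in _ _ _ _ _ _ _ setT J _ dS.
  by move=> b b' e e' /(_ tt Logic.I) -> ee; exact: SJ.
exists m => //; exists S, N; split=> //; split=> // e e' ee x Sx.
exact: (dlm (fun=> x) (fun=> x) _ _ _ _ Sx).
Qed.

Lemma embed_sequences Y (J : set Y) : injects J Tau -> exists e : Y -> X, inj_on J e.
Proof.
move=> JT; have [f fI] := injects_trans JT Tau_X.
have [i _] := X_infinite.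
exists (fun y => if pselect (J y) is left Jy then f (exist _ y (mem_set Jy)) else i 0).
move=> y z Jy Jz; case: pselect => // Jy'; case: pselect => // Jz' /fI.
by case.
Qed.

(** To have only [Tau]-many formulas, algebraic formulas are written in the fixed sequence
    variables [nat + nat]: [inl i] stands for the [i]-th entry of a list of parameters
    and [inr n] for the [n]-th new sequence. *)
Definition param Y (ys : seq Y) (z : nat + nat) : Y + nat :=
  match z with inl i => nth (inr 0) (map inl ys) i | inr n => inr n end.

Definition param_set Y (phi : eq_formula (ctx sigma unit (nat + nat))) (ys : seq Y)
    (f : Y + nat -> X) (x : M) : Prop :=
  eq_sat (ctx_val (fun=> x) (f \o param ys)) phi.

(** Every element is algebraic over finitely many sequences; these are split
    into those coming from [J] and the others. *)
Lemma algebraic_split Y (J : set Y) (e : Y -> X) (h : nat -> X) (a : M) :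
  injective h -> (forall y n, J y -> h n <> e y) ->
  exists phi ys N (h' : nat -> X),
  [/\ forall y, In y ys -> J y, injective h', forall y n, J y -> h' n <> e y,
      param_set phi ys (sum_val e h') a & atmost N (param_set phi ys (sum_val e h'))].
Proof.
move=> hI he; have [psi [s [psia sP]]] := algebraic_in_X a.
pose P : cfg_pred unit X := fun b f => eq_sat (ctx_val b f) psi.
have dP : definable P by exists psi.
have [l [m dlm]] := definable_support dP.
have [ys ysJ ysP] : exists2 ys, forall y, In y ys -> J y &
    forall x, In x m -> (exists2 y, J y & e y = x) ->
      exists i y, onth ys i = Some y /\ e y = x.
  elim: (m) => [|x m' [ys ysJ ysP]]; first by exists [::].
  case: (pselect (exists2 y, J y & e y = x)) => [[y Jy yx]|nx].
    exists (y :: ys) => [z [<-|/ysJ]//|z [<- _|zm /(ysP _ zm)[i [u [iu uz]]]]].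
      by exists 0, y.
    by exists i.+1, u.
  by exists ys => // z [<- //|]; exact: ysP.
have [m' m'P] := list_filter (fun x => ~ exists2 y, J y & e y = x) m.
have [n [y [yI ym]]] := list_enum m'.
have [r rP] := tail_avoids m' hI.
(* the other sequences needed for [a], continued by a tail of [h] *)
pose h' i := if insub i is Some k then y k else h (r + i).
have h'y (k : 'I_n) : h' k = y k by rewrite /h' valK.
have ym' k : In (y k) m' by apply/ym; exists k.
have h'I : injective h'.
  move=> i k; rewrite /h'; case: insubP => [i' _ <-|_]; case: insubP => [k' _ <-|_].
  - by move=> /yI ->.
  - by move=> eik; case: (rP k); rewrite -eik.
  - by move=> eik; case: (rP i); rewrite eik.
  - by move=> /hI/addnI.
have h'J z i : J z -> h' i <> e z.
  move=> Jz; rewrite /h'; case: insubP => [k _ _|_]; last exact: he.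
  by move=> eik; have [_] := proj1 (m'P _) (ym' k); apply; exists z.
have /choice[g gP] : forall x, exists z, In x m -> sum_val e h' (param ys z) = x.
  move=> x; case: (pselect (exists2 z, J z & e z = x)) => xe.
    case: (pselect (In x m)) => xm; last by exists (inl 0).
    have [i [z [iz zx]]] := ysP _ xm xe.
    by exists (inl i) => _ /=; rewrite (onth_nth_map inl (inr 0) iz).
  case: (pselect (In x m)) => xm; last by exists (inl 0).
  have [k kx] : exists k, y k = x by apply/ym/m'P.
  by exists (inr (k : nat)) => _ /=; rewrite h'y.
have [phi phiP] := definable_rename id g dP.
have psE x : param_set phi ys (sum_val e h') x <-> P (fun=> x) id.
  rewrite /param_set -phiP; split; apply: dlm => // z zm /=; by rewrite gP.
exists phi, ys, (size s), h'; split=> //; first exact/psE.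
by exists s => // x /psE/sP.
Qed.

Lemma definable_realized V Z (S : (Z -> X) -> M -> Prop) rho (v0 : V) :
  definable ((fun b e => S e (b tt)) : cfg_pred unit Z) -> home_definable rho ->
  definable ((fun d f => exists2 x, S f x & rho (upd d v0 x)) : cfg_pred V Z).
Proof.
move=> dS [phi phiP].
pose Q : cfg_pred (option V) Z := fun d f => S f (d None) /\ sat (d \o bind v0) phi.
have dQ : definable Q.
  apply: definable_and; first exact: (definable_rename (fun=> None) id dS).
  exact: (definable_rename (bind v0) id (definable_home I Z phi)).
apply: (definable_ext _ (definable_ex dQ)) => d f.
split=> [[x [Sx rx]]|[x Sx /phiP rx]]; exists x => //.
  by apply/phiP; rewrite -oapp_bind.
by split=> //; rewrite oapp_bind.
Qed.

(** If no algebraic formula over [J] and the new sequences [j n] were compatible with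
    the home type of [v0] over [K], each would be excluded by a property [rho] of [v0].
    Closing off under the parameters of these properties gives a subconfiguration of
    size at most [Tau] with the same defect.  It is realized in [M], where by saturation
    [v0] is realized too, and this by an element algebraic over the sequences. *)
Lemma realize_by_algebraic V Y (U : set_system (cfg I V Y)) (K : set V) (J : set Y)
    (j : nat -> Y) (v0 : V) :
  UltraFilter U -> generic U -> (forall v, K v -> algebraic U J v) -> ~ K v0 ->
  injective j -> (forall n, ~ J (j n)) ->
  exists S N, [/\ defset (J `|` range j) S, ae U (fun _ e => atmost N (S e)) &
    forall rho, home_definable rho -> home_depends (K `|` [set v0]) rho ->
      ae U (fun b _ => rho b) -> ae U (fun b e => exists2 x, S e x & rho (upd b v0 x))].
Proof.
move=> UU Ug Kalg Kv0 jI jJ; apply: contrapT => Hno.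
pose C := eq_formula (ctx sigma unit (nat + nat)).
pose Sc (w : C * seq Y) (e : Y -> X) := param_set w.1 w.2 (sum_val e (e \o j)).
have Scdef w (J' : set Y) : (forall y, In y w.2 -> J' y) -> defset (J' `|` range j) (Sc w).
  move=> wJ; split.
    have dphi : definable ((fun b e => eq_sat (ctx_val b e) w.1) : cfg_pred unit (nat + nat)).
      by exists w.1.
    pose q (z : Y + nat) : Y := match z with inl y => y | inr n => j n end.
    apply: (definable_ext _ (definable_rename id (q \o param w.2) dphi)) => b e.
    rewrite /Sc /param_set.
    have -> : b \o id = fun=> b tt by apply: funext => -[].
    by have -> : e \o (q \o param w.2) = sum_val e (e \o j) \o param w.2
      by apply: funext => z /=; case: (param w.2 z).
  move=> e e' ee x; rewrite /Sc /param_set.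
  suff -> : sum_val e (e \o j) \o param w.2 = sum_val e' (e' \o j) \o param w.2 by [].
  apply: funext => -[i|n] /=; last by apply: ee; right; exists n.
  have : forall z, In z (map inl w.2) \/ z = inr 0 -> sum_val e (e \o j) z = sum_val e' (e' \o j) z.
    move=> z [zw|->] /=; last by apply: ee; right; exists 0.
    have [y [<- yw]] := proj1 (List.in_map_iff _ _ _) zw.
    by apply: ee; left; exact: wJ.
  apply; case: (ltnP i (size (map (inl : Y -> Y + nat) w.2))) => iw; last first.
    by right; rewrite nth_default.
  left; elim: (map inl w.2) i iw => //= z s IH [|i] /= iw; first by left.
  by right; exact: IH.
pose bad w (rho : (V -> M) -> Prop) := [/\ home_definable rho,
  home_depends (K `|` [set v0]) rho, ae U (fun b _ => rho b) &
  ~ ae U (fun b e => exists2 x, Sc w e x & rho (upd b v0 x))].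
have Hbad w N : (forall y, In y w.2 -> J y) ->
    ae U (fun _ e => atmost N (Sc w e)) -> exists rho, bad w rho.
  move=> wJ UN; apply: contrapT => nbad; apply: Hno.
  exists (Sc w), N; split=> // [|rho d1 d2 d3]; first exact: Scdef.
  by apply: contrapT => n; apply: nbad; exists rho.
(* a bad property, the home variables in it other than [v0], and sequences over which
   these are algebraic *)
have /choice[W WP] : forall w, exists t : ((V -> M) -> Prop) * (seq V * seq Y),
    (exists rho, bad w rho) -> [/\ bad w t.1, forall v, In v t.2.1 -> K v,
      home_depends ([set v | In v t.2.1] `|` [set v0]) t.1,
      forall y, In y t.2.2 -> J y &
      forall v, In v t.2.1 -> algebraic U [set y | In y t.2.2] v].
  move=> w; case: (pselect (exists rho, bad w rho)) => [[rho brho]|nb]; last first.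
    by exists (fun=> True, ([::], [::])).
  have [rdef rdep _ _] := brho; have [l lK dl] := home_support rdef rdep.
  have [l' l'P] := list_filter K l.
  have [m' m'J m'alg] : exists2 m', forall y, In y m' -> J y &
      forall v, In v l' -> algebraic U [set y | In y m'] v.
    have : forall v, In v l' -> K v by move=> v /l'P[].
    elim: (l') => [|v l1 IH] lK1; first by exists [::].
    have [|m1 m1J m1alg] := IH; first by move=> u ul; apply: lK1; right.
    have [m2 m2J m2alg] := algebraic_finite (Kalg v (lK1 v (or_introl erefl))).
    exists (m1 ++ m2) => [y /In_cat[/m1J|/m2J]//|u [<-|/m1alg]].
      by apply: algebraic_mono m2alg => y ym; apply/In_cat; right.
    by apply: algebraic_mono => y ym; apply/In_cat; left.
  exists (rho, (l', m')) => _; split=> //= [v /l'P[]//|].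
  move=> b b' bb; apply: dl => v vl.
  by apply: bb; case: (lK v vl) => [Kv|->]; [left; apply/l'P|right].
have NT X' : injects X' nat -> injects X' Tau by move=> XN; apply: injects_trans XN Tinf.
have CT : injects C Tau.
  apply: injects_form => //; first exact: injects_refl.
    by apply: NT; exists (fun=> 0) => -[] [].
  by apply: NT; apply: injects_sum_into; exact: injects_refl.
have [Y1 [Y1T Y1cl]] := small_closure (fun phi ys => (W (phi, ys)).2.2) Tinf CT.
pose Y2 := Y1 `&` J.
have Y2T : injects Y2 Tau by apply: injects_trans Y1T; apply: injects_sub => y [].
pose K2 : set V := [set v | exists p : C * seq Y2,
  In v (if pselect (exists rho, bad (p.1, map val p.2) rho) is left _
        then (W (p.1, map val p.2)).2.1 else [::])].
have K2T : injects K2 Tau.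
  apply: injects_seq_image => //; apply: injects_prod_into => //.
  exact: injects_seq.
have valY2 (s : seq Y2) y : In y (map val s) -> Y1 y /\ J y.
  by move=> /List.in_map_iff[z [<- _]]; exact: set_mem (valP z).
have K2alg v : K2 v -> K v /\ algebraic U Y2 v.
  move=> [[phi s] /=]; case: pselect => // ex vW.
  have [_ WK _ WJ Walg] := WP _ ex; split; first exact: WK.
  apply: algebraic_mono (Walg _ vW) => y yW; split; last exact: WJ.
  by apply: Y1cl yW => z /valY2[].
pose J2 := Y2 `|` range j.
(* realization of the small configuration in [M] *)
have [e eI] : exists e : Y -> X, inj_on J2 e.
  apply: embed_sequences; apply: injects_setU => //.
  apply: NT; apply: (injects_rel (R := fun y n => j n = val y)).
    by move=> [y yr]; have [n _ jn] := set_mem yr; exists n; exact: jn.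
  by move=> y y' n /= -> /val_inj.
have eI2 : inj_on Y2 e by move=> y z Yy Yz; apply: eI; left.
have ejI : injective (e \o j).
  by move=> m n /= emn; apply/jI/eI => //; right; [exists m|exists n].
have ejY y n : Y2 y -> (e \o j) n <> e y.
  move=> Yy /= ejy; have jy : j n = y by apply: eI => //; [right; exists n|left].
  by case: (jJ n); rewrite jy; case: Yy.
have [b bU] := @realize_algebraic _ _ _ _ I Iindisc X_infinite _ _ U K2 J2 e UU Ug
  (fun v Kv => algebraic_mono (@subsetUl _ Y2 (range j)) (proj2 (K2alg v Kv))) eI.
have ultra_b (P : cfg_pred V Y) : definable P -> depends K2 J2 P -> P b e -> ae U P.
  move=> dP DP Pb; apply: contrapT => /(proj1 (ultra_not _)) nU.
  apply: (bU (fun b e => ~ P b e)) => //; first exact: definable_not.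
  by move=> d d' f f' dd ff n Pd'; apply: n; apply: DP Pd' => [v|y] h; rewrite ?dd ?ff.
have Kb v : K2 v -> exists S N, [/\ defset Y2 S, S e (b v) & atmost N (S e)].
  move=> K2v; have [Kv [S [N [dS US]]]] := K2alg v K2v.
  exists S, N; split=> //.
    have [dSv DSv] := defset_at v dS.
    apply: (bU (fun b e => S e (b v))) => //.
      by apply: depends_sub DSv => [_ ->|y]; [|left].
    by apply: filterS US => w [].
  have [dN DN] := defset_atmost V N dS.
  apply: (bU (fun b e => atmost N (S e))) => //.
    by apply: depends_sub DN => [v' []|y]; left.
  by apply: filterS US => w [].
have UUV := ultrafilter_pushforward fst UU.
have [|c cP] := realize_home UUV K2T (fun K2v => Kv0 (proj1 (K2alg v0 K2v))) _ (b := b).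
  move=> P [phi phiP] PK UP; apply: (bU (fun b _ => P b)) => //.
    exact: (definable_ext (fun b _ => iff_sym (phiP b)) (definable_home I Y phi)).
  by move=> d d' f f' dd _; exact: PK.
(* [c] is algebraic over [e] on [Y2] and some new sequences [h'], which may be replaced
   by the sequences [e (j n)]; but the formula in question was excluded by [rho] *)
have [phi [ys [N [h' [ysY h'I h'Y cphi Nphi]]]]] := algebraic_split c ejI ejY.
pose w : C * seq Y := (phi, ys).
have dphi : definable ((fun d f => param_set phi ys f (d tt)) : cfg_pred unit (Y + nat)).
  have d0 : definable ((fun b e => eq_sat (ctx_val b e) phi) : cfg_pred unit (nat + nat)).
    by exists phi.
  apply: (definable_ext _ (definable_rename id (param ys) d0)) => d f.
  by rewrite /param_set; have -> : d \o id = fun=> d tt by apply: funext => -[].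
pose Y2N : set (Y + nat) := [set z | if z is inl y then Y2 y else True].
have Dphi f f' : (forall z, Y2N z -> f z = f' z) -> forall x,
    param_set phi ys f x -> param_set phi ys f' x.
  move=> ff x; rewrite /param_set.
  suff -> : f \o param ys = f' \o param ys by [].
  apply: funext => -[i|n] /=; last by rewrite ff.
  apply: ff; elim: (ys) i ysY => [|y s IH] [|i] //= ysY; first by apply: ysY; left.
  by apply: IH => z zs; apply: ysY; right.
have ysJ y : In y ys -> J y by move=> /ysY[].
have defphi : defset Y2N (param_set phi ys) by split.
have UN : ae U (fun _ e => atmost N (Sc w e)).
  apply: ultra_b.
  - by have [+ _] := defset_atmost V N (Scdef w Y2 ysY).
  - have [_ +] := defset_atmost V N (Scdef w Y2 ysY).
    by apply: depends_sub.
  - have [dN DN] := defset_atmost V N defphi.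
    apply: (indiscernible_over_algebraic Iindisc X_infinite (P := fun _ f => atmost N (param_set phi ys f))
      eI2 Kb dN _ h'I ejI h'Y ejY Nphi).
    by apply: depends_sub DN.
have ex : exists rho, bad w rho := Hbad w N ysJ UN.
have [[rdef _ Urho nrho] _ rdep _ _] := WP w ex.
set rho := (W w).1 in rdef Urho nrho rdep.
have ysl : exists s : seq Y2, map val s = ys.
  by have [s es] := lift_seq ysY; exists s.
have lK2 v : In v (W w).2.1 -> K2 v.
  move=> vl; have [s es] := ysl; exists (phi, s) => /=; rewrite es.
  by case: pselect.
have rK2 : home_depends (K2 `|` [set v0]) rho.
  move=> d d' dd; apply: rdep => v [vl|vv]; apply: dd; [left; exact: lK2|by right].
have rc : rho (upd b v0 c) by exact: cP.
apply: nrho; apply: ultra_b.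
- apply: definable_realized => //; exact: proj1 (Scdef w Y2 ysY).
- move=> d d' f f' dd ff [x Sx rx]; exists x.
    by apply: (proj2 (Scdef w Y2 ysY)) Sx.
  apply: rK2 rx => v; case: (pselect (v = v0)) => [-> _|vv [K2v|//]].
    by rewrite !upd_same.
  by rewrite !upd_neq //; exact: dd.
- pose P : cfg_pred V (Y + nat) := fun d f => exists2 x, param_set phi ys f x & rho (upd d v0 x).
  apply: (indiscernible_over_algebraic Iindisc X_infinite (P := P) eI2 Kb _ _ h'I ejI h'Y ejY).
  + exact: definable_realized.
  + move=> d d' f f' dd ff [x Sx rx]; exists x; first exact: Dphi Sx.
    apply: rK2 rx => v; case: (pselect (v = v0)) => [-> _|vv [K2v|//]].
      by rewrite !upd_same.
    by rewrite !upd_neq //; exact: dd.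
  + by exists c.
Qed.

(** * Configurations consisting of algebraic elements *)

Section Extension.
Variable V : Type.

Notation Y := (V * nat)%type.

(** The sequences [(v, n)] are reserved for making [v] algebraic. *)
Definition supply (K : set V) : set Y := [set z | K z.1].

(** For ultrafilters, which are maximal, this inclusion is an equality of the restrictions
    to the home variables in [K] and all sequence variables. *)
Definition agree_on (K : set V) (U U' : set_system (cfg I V Y)) :=
  forall P : cfg_pred V Y, depends K setT P -> ae U P -> ae U' P.

Lemma agree_trans (K K' : set V) U U' U'' : K `<=` K' ->
  agree_on K U U' -> agree_on K' U' U'' -> agree_on K U U''.
Proof. by move=> KK a a' P dP /(a P dP); apply: a'; exact: depends_sub dP. Qed.

Lemma algebraic_agree (K : set V) U U' J v :
  agree_on K U U' -> K v -> algebraic U J v -> algebraic U' J v.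
Proof.
move=> a Kv [S [N [[dS SJ] US]]]; exists S, N; split=> //.
apply: a US => b b' e e' /(_ v Kv) -> ee [Sb SN].
have SE x : S e' x -> S e x by apply: SJ => y _; rewrite ee.
by split; [apply: SJ Sb => y _; exact: ee|exact: atmost_sub SN].
Qed.

(** Compactness, for a configuration which is to satisfy all conditions in [F], all
    formulas in [r] and the property [Q]. *)
Lemma ultrafilter_of_conditions (r : set (formula L V)) : (exists phi, r phi) ->
  (forall phi psi, r phi -> r psi ->
    exists2 chi, r chi & forall b : V -> M, sat b chi -> sat b phi /\ sat b psi) ->
  forall (Q : cfg_pred V Y) (F : set (cfg_pred V Y)),
  F (fun _ _ => True) ->
  (forall P P', F P -> F P' -> F (fun b e => P b e /\ P' b e)) ->
  (forall P phi, F P -> r phi -> exists b e, [/\ P b e, sat b phi & Q b e]) ->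
  exists2 U : set_system (cfg I V Y), UltraFilter U &
    [/\ forall P, F P -> ae U P, forall phi, r phi -> ae U (fun b _ => sat b phi) & ae U Q].
Proof.
move=> [phi0 rphi0] rdir Q F FT FI Fr.
pose B : set (set (cfg I V Y)) := [set A | exists P phi, [/\ F P, r phi &
  A = [set w | [/\ P w.1 w.2, sat w.1 phi & Q w.1 w.2]]]].
have [U UU BU] : exists2 U : set_system (cfg I V Y), UltraFilter U & B `<=` U.
  apply: ultrafilter_of_base.
  - by eexists; exists (fun _ _ => True), phi0; split; [exact: FT|exact: rphi0|reflexivity].
  - move=> _ _ [P [phi [FP rphi ->]]] [P' [psi [FP' rpsi ->]]].
    have [chi rchi chiP] := rdir _ _ rphi rpsi.
    eexists; first by exists (fun b e => P b e /\ P' b e), chi; split;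
      [exact: FI|exact: rchi|reflexivity].
    by move=> w [[Pw P'w] /chiP[phiw psiw] Qw].
  - move=> _ [P [phi [FP rphi ->]]]; have [b [e H]] := Fr _ _ FP rphi.
    by exists (b, e).
have H P phi : F P -> r phi -> U [set w | [/\ P w.1 w.2, sat w.1 phi & Q w.1 w.2]].
  by move=> FP rphi; apply: BU; exists P, phi.
exists U => //; split.
- by move=> P FP; apply: filterS (H _ _ FP rphi0) => w [].
- by move=> phi rphi; apply: filterS (H _ _ FT rphi) => w [].
- by apply: filterS (H _ _ FT rphi0) => w [].
Qed.

Lemma depends_and (K : set V) (J : set Y) (P P' : cfg_pred V Y) :
  depends K J P -> depends K J P' -> depends K J (fun b e => P b e /\ P' b e).
Proof.
by move=> d d' b b' e e' bb ee [/(d _ _ _ _ bb ee) ? /(d' _ _ _ _ bb ee)].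
Qed.

Lemma agree_generic (K : set V) U U' : agree_on K U U' -> generic U -> generic U'.
Proof.
move=> a Ug y z yz; apply: a (Ug y z yz) => b b' e e' _ ee.
by rewrite -(ee y Logic.I) -(ee z Logic.I).
Qed.

(** Zorn's lemma, applied to pairs [(K, U)] such that the variables in [K] are algebraic
    in [U], where a larger pair agrees with a smaller one on the smaller set [K].  For a
    variable [v0] outside [K], an algebraic formula compatible with its home type over
    [K] may be imposed on it, and a realization of [r] continues to exist because the
    existence of the elements outside [K] and [v0] is part of that home type. *)
Lemma extend_algebraic (r : set (formula L V)) (K0 K1 : set V) U0 :
  (exists phi, r phi) ->
  (forall phi psi, r phi -> r psi ->
    exists2 chi, r chi & forall b : V -> M, sat b chi -> sat b phi /\ sat b psi) ->
  K0 `<=` K1 -> UltraFilter U0 -> generic U0 ->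
  (forall phi, r phi -> ae U0 (fun b _ => sat b phi)) ->
  (forall v, K0 v -> algebraic U0 (supply K0) v) ->
  exists2 U : set_system (cfg I V Y), UltraFilter U &
   [/\ generic U, forall phi, r phi -> ae U (fun b _ => sat b phi),
      forall v, K1 v -> algebraic U (supply K1) v & agree_on K0 U0 U].
Proof.
move=> rne rdir K01 UU0 Ug0 Ur0 Kalg0.
pose good (p : set V * set_system (cfg I V Y)) := [/\ K0 `<=` p.1 /\ p.1 `<=` K1,
  UltraFilter p.2, forall phi, r phi -> ae p.2 (fun b _ => sat b phi),
  forall v, p.1 v -> algebraic p.2 (supply p.1) v & agree_on K0 U0 p.2].
have goodg p : good p -> generic p.2 by move=> [_ _ _ _ /agree_generic]; exact.
pose stage := {p | good p}.
pose R (p q : stage) := `[< (sval p).1 `<=` (sval q).1 /\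
  agree_on (sval p).1 (sval p).2 (sval q).2 >].
have good0 : good (K0, U0) by do 2?split=> //; move=> P.
have [||A Atot|[[K U] Kgood] Kmax] := @ZL_preorder stage (exist _ _ good0) R.
- by move=> p; apply/asboolP; split=> [v|P].
- move=> q p s /asboolP[h1 h2] /asboolP[h3 h4]; apply/asboolP; split.
    exact: subset_trans h3.
  exact: agree_trans h4.
- case: (pselect (exists p, A p)) => [[p0 Ap0]|nA]; last first.
    by exists (exist _ _ good0) => p Ap; case: nA; exists p.
  pose F : set (cfg_pred V Y) := [set P | exists p : stage, [/\ A p,
    depends (sval p).1 setT P & ae (sval p).2 P]].
  have [U UU [FU rU _]] : exists2 U : set_system (cfg I V Y), UltraFilter U &
    [/\ forall P, F P -> ae U P, forall phi, r phi -> ae U (fun b _ => sat b phi) &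
        ae U (fun _ _ => True)].
    apply: ultrafilter_of_conditions => //.
    + by exists p0; split=> //; case: (svalP p0) => _ UU _ _ _; exact: filterT.
    + move=> P P' [p [Ap dP UP]] [p' [Ap' dP' UP']].
      have [/asboolP[sub ag]|/asboolP[sub ag]] := Atot _ _ Ap Ap'.
        have UU := svalP p'; exists p'; split=> //.
          by apply: depends_and => //; exact: depends_sub dP.
        by case: UU => _ UU _ _ _; exact: filterI (ag _ dP UP) UP'.
      have UU := svalP p; exists p; split=> //.
        by apply: depends_and => //; exact: depends_sub dP'.
      by case: UU => _ UU _ _ _; exact: filterI UP (ag _ dP' UP').
    + move=> P phi [p [Ap dP UP]] rphi; have [_ UU pr _ _] := svalP p.
      have [w [w1 w2]] := filter_ex (filterI UP (pr _ rphi)).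
      by exists w.1, w.2.
  have ag (p : stage) : A p -> agree_on (sval p).1 (sval p).2 U.
    by move=> Ap P dP UP; apply: FU; exists p.
  have gU : good (\bigcup_(p in A) (sval p).1, U).
    split=> //=; first split.
    + by move=> v v0; exists p0 => //; case: (svalP p0) => -[+ _] _ _ _ _; exact.
    + by move=> v [p Ap pv]; case: (svalP p) => -[_ +] _ _ _ _; exact.
    + move=> v [p Ap pv]; have [_ _ _ palg _] := svalP p.
      apply: (algebraic_agree (ag p Ap) pv).
      by apply: algebraic_mono (palg v pv) => z zp; exists p.
    + have [[sub _] _ _ _ ag0] := svalP p0.
      exact: agree_trans (ag p0 Ap0).
  exists (exist _ _ gU) => p Ap; apply/asboolP; split; last exact: ag.
  by move=> v pv; exists p.
have [[/= K0K KK1] UU Ur Kalg ag0] := Kgood.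
have Ug : generic U := goodg _ Kgood.
case: (pselect (K1 `<=` K)) => [K1K|/existsNP[v0 /not_implyP[K1v0 nKv0]]].
  by exists U => //; split=> //; have <- : K = K1 by apply/seteqP.
exfalso.
pose j n : Y := (v0, n).
have jI : injective j by move=> m n [].
have jJ n : ~ supply K (j n) by [].
have [S [N [dS UN key]]] := realize_by_algebraic UU Ug Kalg nKv0 jI jJ.
have [U' UU' [FU' rU' SU']] : exists2 U' : set_system (cfg I V Y), UltraFilter U' &
    [/\ forall P, [set P | depends K setT P /\ ae U P] P -> ae U' P,
        forall phi, r phi -> ae U' (fun b _ => sat b phi) &
        ae U' (fun b e => S e (b v0))].
  apply: ultrafilter_of_conditions => //.
  - by split=> //; exact: filterT.
  - by move=> P P' [dP UP] [dP' UP']; split; [exact: depends_and|exact: filterI UP UP'].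
  - move=> P phi [dP UP] rphi; have [s sP] := formula_support phi.
    (* the variables of [phi] that are to be chosen anew *)
    have [l lP] := list_filter (fun v => ~ (K v \/ v = v0)) s.
    have rdep : home_depends (K `|` [set v0]) (fun b : V -> M => sat b (exqs l phi)).
      move=> b b' bb /sat_exqs[w wb wphi]; apply/sat_exqs.
      pose w' v := if `[< In v l >] then w v else b' v.
      exists w' => [v vl|]; first by rewrite /w'; case: asboolP.
      apply: (proj1 (sP M w w' _)) wphi => v vs; rewrite /w'; case: asboolP => // nvl.
      rewrite wb //; apply: bb; apply: contrapT => nv.
      by apply: nvl; apply/lP; split.
    have Urho : ae U (fun b _ => sat b (exqs l phi)).
      by apply: filterS (Ur _ rphi) => w wphi; apply/sat_exqs; exists w.1.
    have Uex := key _ (ex_intro _ (exqs l phi) (fun b => iff_refl _)) rdep Urho.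
    have [[b e] [/= Pb [x Sx /sat_exqs[w wb wphi]]]] := filter_ex (filterI UP Uex).
    exists w, e; split=> //.
      apply: dP Pb => // v Kv; rewrite wb ?upd_neq //; first by move=> vv; rewrite vv in Kv.
      by move=> /lP[_ nv]; apply: nv; left.
    by rewrite wb ?upd_same // => /lP[_ nv]; apply: nv; right.
have agU : agree_on K U U' by move=> P dP UP; exact: FU'.
have gU : good (K `|` [set v0], U').
  split=> //=; first split.
  - by move=> v /K0K; left.
  - by move=> v [/KK1//|->].
  - move=> v [Kv|->].
      apply: (algebraic_agree agU Kv); apply: algebraic_mono (Kalg v Kv) => z; by left.
    exists S, N; split.
      apply: defset_sub dS => z [zK|[n _ <-]]; [by left|by right].
    apply: filterI SU' _; apply: agU UN => b b' e e' _ ee.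
    have [_ SJ] := dS; apply: atmost_sub => x; apply: SJ => y _.
    by rewrite ee.
  - exact: agree_trans agU.
have /asboolP[sub _] : R (exist _ _ gU) (exist _ _ Kgood).
  by apply: Kmax; apply/asboolP; split=> //= v; left.
by apply: nKv0; apply: sub; right.
Qed.
End Extension.

(** * Counting types *)

Variable T : theory L.
Hypothesis Tc : complete T.
Hypothesis MT : models M T.

(** First [A] is made algebraic over some sequences, by a type [UA]; then, for each type
    [p] over [A], its realization is made algebraic as well, by a type [Up p] which agrees
    with [UA] on [A] and the sequences.  The formula [Phi p] over the latter, satisfied by
    the realization and with as few solutions as possible, implies each [theta] in [p],
    for otherwise its conjunction with [theta] has fewer solutions.  What it implies is
    decided by [UA], so [Phi p] determines [p]. *)
Lemma injects_type_space (N : structure L) (A : set N) n (Lambda : Type) :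
  models N T -> injects Tau Lambda -> injects A Lambda ->
  injects (type_space A n) Lambda.
Proof.
move=> NT TL AL; have Linf : infinite Lambda := injects_trans Tinf TL.
pose V := ('I_n + A)%type; pose Y := (V * nat)%type.
pose KA : set V := [set v | if v is inr _ then True else False].
have [b0 _] : exists b : 'I_n -> N, True.
  by have [a] := carrier_inhabited N; exists (fun=> a).
pose rA : set (formula L V) := [set phi | sat (sum_val b0 (fun a : A => val a)) phi].
have rAdir phi psi : rA phi -> rA psi ->
    exists2 chi, rA chi & forall b : V -> M, sat b chi -> sat b phi /\ sat b psi.
  by move=> h1 h2; exists (And phi psi) => [|b /satAE//]; apply/satAE.
have rAne : exists phi, rA phi by exists (Neg Bot).
have [U0 UU0 [F0 r0 _]] : exists2 U : set_system (cfg I V Y), UltraFilter U &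
    [/\ forall P : cfg_pred V Y,
        [set P | exists m : seq Y, forall b e, inj_on [set y | In y m] e -> P b e] P -> ae U P,
      forall phi, rA phi -> ae U (fun b _ => sat b phi) & ae U (fun _ _ => True)].
  apply: ultrafilter_of_conditions => //.
  - by exists [::].
  - move=> P P' [m mP] [m' mP']; exists (m ++ m') => b e eI.
    by split; [apply: mP|apply: mP'] => y z ym zm; apply: eI; apply/In_cat; tauto.
  - move=> P phi [m mP] rphi.
    have [b bphi] : exists b : V -> M, sat b phi.
      by apply: (sat_transfer Tc NT MT); exists (sum_val b0 (fun a : A => val a)).
    have mT : injects [set y | In y m] Tau.
      apply: injects_trans Tinf; apply: (injects_rel (R := fun y k => onth m k = Some (val y))).
        by move=> [y yr]; have := set_mem yr => /= h; exact: In_nth_error h.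
      by move=> y y' k /= -> [e]; exact: val_inj.
    have [e eI] := embed_sequences mT.
    by exists b, e; split=> //; exact: mP.
have U0g : generic U0.
  move=> y z yz; apply: F0; exists [:: y; z] => b e eI eyz; apply: yz; apply: eI => //=.
    by left.
  by right; left.
have [v []|UA UUA [UAg UAr UAalg _]] := extend_algebraic rAne rAdir (@sub0set _ KA) UU0 U0g r0 _.
have Up_ex : forall p, exists U : set_system (cfg I V Y), complete_type p ->
    UltraFilter U /\
    [/\ forall phi, p phi -> ae U (fun b _ => sat b phi),
       forall v, algebraic U (supply setT) v & agree_on KA UA U].
  move=> p; case: (pselect (complete_type p)) => [pc|npc]; last by exists UA.
  have pdir phi psi : p phi -> p psi ->
      exists2 chi, p chi & forall b : V -> M, sat b chi -> sat b phi /\ sat b psi.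
    move=> h1 h2; exists (And phi psi) => [|b /satAE//]; exact: type_and.
  have [U1 UU1 [F1 r1 _]] : exists2 U : set_system (cfg I V Y), UltraFilter U &
    [/\ forall P, [set P | depends KA setT P /\ ae UA P] P -> ae U P,
      forall phi, p phi -> ae U (fun b _ => sat b phi) & ae U (fun _ _ => True)].
    apply: ultrafilter_of_conditions => //.
    - exact: type_nonempty pc.
    - by split=> //; exact: filterT.
    - by move=> P P' [dP UP] [dP' UP']; split; [exact: depends_and|exact: filterI UP UP'].
    - move=> P phi [dP UP] pphi; pose l : seq V := [seq inl i | i <- enum 'I_n].
      have rex : rA (exqs l phi).
        have [|b bP] := type_sat pc (l := [:: phi]); first by move=> x [<-|[]].
        apply/sat_exqs; exists (sum_val b (fun a : A => val a)); last by apply: bP; left.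
        by move=> [i|a] //= il; case: il; apply: List.in_map; apply: mem_In; rewrite mem_enum.
      have [[b e] [/= Pb /sat_exqs[w wb wphi]]] := filter_ex (filterI UP (UAr _ rex)).
      exists w, e; split=> //; apply: dP Pb => // -[i []|a _]; rewrite wb //.
      by move=> /List.in_map_iff[i []].
  have ag1 : agree_on KA UA U1 by move=> P dP UP; apply: F1.
  have [v Kv|U UU [Ug Ur Ualg ag2]] := extend_algebraic
    (type_nonempty pc) pdir (@subsetT _ KA) UU1 (agree_generic ag1 UAg) r1 _.
    exact: (algebraic_agree ag1 Kv (UAalg v Kv)).
  exists U => _; split=> //; split=> //; last exact: agree_trans ag2.
  by move=> v; exact: Ualg.
have [Up UpP] := choice Up_ex.
(* [phi] as a condition on a tuple [x], the elements of [A] and the sequences being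
   parameters *)
pose fib (phi : eq_formula (ctx sigma V Y)) (b : V -> M) (e : Y -> X) (x : 'I_n -> M) :=
  eq_sat (ctx_val (sum_val x (b \o inr)) e) phi.
pose good p phi k := ae (Up p) (fun b e => eq_sat (ctx_val b e) phi) /\
  ae (Up p) (fun b e => atmost k (fib phi b e)).
have bE (b : V -> M) : sum_val (b \o inl) (b \o inr) = b by apply: funext => -[].
have good_ex p : complete_type p -> exists k phi, good p phi k.
  move=> pc; have [UU [_ alg _]] := UpP p pc.
  have /choice[S /choice[N0 SP]] := fun i : 'I_n => alg (inl i).
  have [k kP] := atmost_tuples N0.
  have [phi phiP] : definable ((fun b e => forall i, In i (enum 'I_n) -> S i e (b (inl i))) : cfg_pred V Y).
    apply: definable_forall_list => i _; have [dS _] := SP i.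
    by have [] := defset_at (inl i : V) dS.
  have USN : ae (Up p) (fun b e => forall i, In i (enum 'I_n) ->
      S i e (b (inl i)) /\ atmost (N0 i) (S i e)).
    by apply: (@ultra_forall_list _ _ UU) => i _; have [_] := SP i.
  have inE' i : In i (enum 'I_n) by apply: mem_In; rewrite mem_enum.
  exists k, phi; split; apply: filterS USN => w wP; first by apply/phiP => i /wP[].
  have h := kP M (fun i => S i w.2) (fun i => proj2 (wP i (inE' i))).
  by apply: atmost_sub h => x /phiP xS i; exact: xS (inE' i).
have /choice[Phi PhiP] : forall p, exists phi, complete_type p ->
    exists2 k, good p phi k & forall phi' k', good p phi' k' -> (k <= k')%N.
  move=> p; case: (pselect (complete_type p)) => [pc|npc]; last by exists (EqBot _).
  have [k [phi g] kmin] := least_nat (good_ex p pc).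
  by exists phi => _; exists k => // phi' k' g'; apply: kmin; exists phi'.
pose implies phi theta := ae UA (fun b e => forall x, fib phi b e x ->
  sat (sum_val x (b \o inr)) theta).
have imp_dep phi theta : depends KA setT ((fun b e => forall x, fib phi b e x ->
    sat (sum_val x (b \o inr)) theta) : cfg_pred V Y).
  move=> b b' e e' bb ee; rewrite /fib.
  have -> : b' \o inr = b \o inr by apply: funext => a /=; rewrite bb.
  by have -> : e' = e by apply: funext => y; rewrite ee.
have typeE p theta : complete_type p -> p theta <-> implies (Phi p) theta.
  move=> pc; have [k [g1 g2] kmin] := PhiP p pc; have [UU [Ur _ ag]] := UpP p pc.
  split=> [pt|H].
    apply: contrapT => /(proj1 (ultra_not _)) nU.
    have nU' : ae (Up p) (fun b e => ~ forall x, fib (Phi p) b e x ->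
        sat (sum_val x (b \o inr)) theta).
      apply: ag nU => b b' e e' bb ee; apply: contra_not; apply: imp_dep => [v Kv|y _].
        by rewrite bb.
      by rewrite ee.
    have [phi' phiP'] : definable ((fun b e => eq_sat (ctx_val b e) (Phi p) /\
        sat b theta) : cfg_pred V Y).
      by apply: definable_and (definable_home I Y theta); exists (Phi p).
    have fib' b e x : fib phi' b e x <-> fib (Phi p) b e x /\ sat (sum_val x (b \o inr)) theta.
      by rewrite /fib -phiP'.
    case: k g2 kmin => [|k] g2 kmin.
      have [w [w1 w2]] := filter_ex (filterI g1 g2).
      by move/atmost0: w2 => /(_ (w.1 \o inl)); rewrite /fib bE.
    have : (k.+1 <= k)%N; last by rewrite ltnn.
    apply: (kmin phi'); split.
      by apply: filterS (filterI g1 (Ur _ pt)) => w H; apply/phiP'.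
    apply: filterS (filterI g2 nU') => w [w1 w2].
    apply: contrapT => nat; apply: w2 => x xPhi; apply: contrapT => nx; apply: nat.
    by apply: (atmost_drop (a := x)) w1 => // [z /fib'[]//|/fib'[]].
  case: (proj1 pc theta) => // /Ur nt.
  have Hp : ae (Up p) (fun b e => forall x, fib (Phi p) b e x ->
    sat (sum_val x (b \o inr)) theta) := ag _ (imp_dep _ _) H.
  have [w [[w1 w2] w3]] := filter_ex (filterI (filterI Hp g1) nt).
  by exfalso; apply: w3; rewrite -(bE w.1); apply: w1; rewrite /fib bE.
have inj_form : injects (type_space A n) (eq_formula (ctx sigma V Y)).
  exists (fun p => Phi (val p)) => p q ePhi; apply: val_inj.
  have pc : complete_type (val p) := set_mem (valP p).
  have qc : complete_type (val q) := set_mem (valP q).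
  apply/seteqP; split=> theta.
    by move/(typeE _ _ pc); rewrite ePhi => /(typeE _ _ qc).
  by move/(typeE _ _ qc); rewrite -ePhi => /(typeE _ _ pc).
apply: injects_trans inj_form _.
have VL : injects V Lambda by apply: injects_sum_into => //; exact: injects_ord.
by apply: injects_form => //; exact: injects_prod_into.
Qed.

End AlgebraicOverIndiscernibles.

(** * Morley rank *)

Lemma cantor : ~ injects (nat -> bool) nat.
Proof.
move=> [h hI]; pose d n := `[< exists2 f, h f = n & f n = false >].
have := erefl (d (h d)); rewrite {1}/d; case: asboolP => [[f /hI ->] -> //|nd dd].
by apply: nd; exists d.
Qed.

Section OmegaStable.
Variables (L : language) (M : structure L) (n : nat).
Notation form := (formula L ('I_n + M)).

Definition unranked (phi : form) := forall alpha, morley_rank_ge alpha phi.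

(** There are set-many formulas, so some ordinal bounds all their ranks; a formula
    of rank above that bound splits into formulas of rank above that bound. *)
Lemma unranked_split : exists s : form -> bool -> form, forall phi, unranked phi ->
  (forall c, unranked (s phi c) /\ def_set (s phi c) `<=` def_set phi) /\
  def_set (s phi true) `&` def_set (s phi false) = set0.
Proof.
have /choice[al alP] : forall phi : form, exists alpha, ~ unranked phi -> ~ morley_rank_ge alpha phi.
  move=> phi; case: (pselect (unranked phi)) => [u|/existsNP[alpha h]]; last by exists alpha.
  by exists OZero.
have /choice[s sP] : forall phi, exists s : bool -> form, unranked phi ->
    (forall c, unranked (s c) /\ def_set (s c) `<=` def_set phi) /\
    def_set (s true) `&` def_set (s false) = set0; last by exists s.
move=> phi; case: (pselect (unranked phi)) => [u|nu]; last by exists (fun=> phi).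
have [psi [sub triv ge]] := u (OSucc (OSup al)).
have psiu k : unranked (psi k).
  by apply: contrapT => /alP; apply; case: (ge k) => _; apply.
exists (fun c => psi (nat_of_bool c)) => _; split=> [c|]; first by split.
apply: contrapT => /eqP/set0P ne.
by have := triv 1 0 Logic.I Logic.I ne.
Qed.

(** Splitting a formula without rank again and again gives a binary tree of formulas, in
    which different branches lie in different types over the countably many parameters. *)
Lemma ranked_of_stable (T : theory L) : models M T -> stable_in T nat ->
  forall phi : form, exists alpha, ~ morley_rank_ge alpha phi.
Proof.
move=> MT st phi; apply: contrapT => nex.
have {nex}u : unranked phi.
  by move=> alpha; apply: contrapT => h; apply: nex; exists alpha.
have [s sP] := unranked_split.
pose node (l : seq bool) : form := foldl s phi l.
have nodeS l c : node (rcons l c) = s (node l) c by rewrite /node foldl_rcons.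
have nodeu l : unranked (node l).
  elim/last_ind: l => // l c IH; rewrite nodeS.
  by case: (sP _ IH) => /(_ c)[].
have [a0] := carrier_inhabited M.
(* the parameters occurring in the tree of formulas *)
have /choice[supp suppP] := fun l => formula_support (node l).
pose params l : seq M := pmap (fun x => if x is inr m then Some m else None) (supp l).
pose A : set M := [set a0] `|` [set m | exists l, In m (params l)].
have natinf : infinite nat := injects_refl nat.
have boolN : injects bool nat by exists nat_of_bool => -[] [].
have AN : A #<= [set: nat].
  apply/card_le_setT/injects_setU => //.
    by exists (fun=> 0) => x y _; apply: val_inj; rewrite (set_mem (valP x)) (set_mem (valP y)).
  by apply: injects_seq_image => //; exact: injects_seq.
pose inA m : A := if pselect (A m) is left Am then exist _ m (mem_set Am)
  else exist _ a0 (mem_set (or_introl erefl : A a0)).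
pose restr (theta : form) : formula L ('I_n + A) :=
  frename (fun x => match x with inl i => inl i | inr m => inr (inA m) end) theta.
have restrP l b : sat_over b (restr (node l)) <-> def_set (node l) b.
  rewrite /sat_over /restr /def_set /= sat_frename; apply: suppP => -[i|m] //= xs.
  rewrite /inA; case: pselect => //= nA; case: nA; right; exists l.
  exact: (In_pmap xs).
have branch (f : nat -> bool) : exists U : set_system ('I_n -> M),
    UltraFilter U /\ forall k, U (def_set (node (mkseq f k))).
  have sub k m : (k <= m)%N -> def_set (node (mkseq f m)) `<=` def_set (node (mkseq f k)).
    move=> /subnKC <-; elim: (m - k)%N => [|j IH]; first by rewrite addn0.
    rewrite addnS mkseqS nodeS; apply: subset_trans IH.
    by case: (sP _ (nodeu (mkseq f (k + j)))) => /(_ (f (k + j)))[].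
  have [||U UU BU] := @ultrafilter_of_base _ [set S | exists k, S = def_set (node (mkseq f k))]
    (ex_intro _ _ (ex_intro _ 0 erefl)) _ _.
  + move=> _ _ [k ->] [m ->]; exists (def_set (node (mkseq f (maxn k m)))); first by eexists.
    by move=> b h; split; apply: sub h; [exact: leq_maxl|exact: leq_maxr].
  + by move=> _ [k ->]; exact: nodeu (mkseq f k) OZero.
  + by exists U; split=> // k; apply: BU; exists k.
have [U UP] := choice branch.
pose p f : set (formula L ('I_n + A)) := [set theta | U f [set b | sat_over b theta]].
have pc f : complete_type (p f).
  have [UU _] := UP f; split=> [theta|F /finite_set_list[l lF] Fp].
    exact: in_ultra_setVsetC.
  have [l' l'P] := list_filter F l.
  have h : U f [set b | forall theta, In theta l' -> sat_over b theta].
    by apply: ultra_forall_list => theta /l'P[_ /Fp].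
  have [b bP] := filter_ex h.
  by exists b => theta Ft; apply: bP; apply/l'P; split=> //; exact: lF.
have pI : injective p.
  move=> f g pfg; apply: contrapT => fg.
  have [k fgk kmin] : exists2 k, f k <> g k & forall m, f m <> g m -> (k <= m)%N.
    apply: least_nat; apply: contrapT => nk; apply: fg; apply: funext => k.
    by apply: contrapT => h; apply: nk; exists k.
  have ek : mkseq g k = mkseq f k.
    apply/eq_in_map => m; rewrite mem_iota add0n => /andP[_ mk].
    by apply: contrapT => h; have := kmin m (fun e => h (esym e)); rewrite leqNgt mk.
  have [UUg Ug] := UP g; have [UUf Uf] := UP f.
  have pfk : p f (restr (node (mkseq f k.+1))).
    by apply: filterS (Uf k.+1) => b; apply: iffRL; exact: restrP.
  rewrite pfg in pfk.
  have [b [bf bg]] := filter_ex (filterI pfk (Ug k.+1)).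
  move: bf bg => /restrP; rewrite !mkseqS ek !nodeS.
  have [_ disj] := sP _ (nodeu (mkseq f k)).
  have no : forall b, ~ (def_set (s (node (mkseq f k)) true) b /\
      def_set (s (node (mkseq f k)) false) b) by move=> c; rewrite -[_ /\ _]/((_ `&` _) c) disj.
  by case: (f k) (g k) fgk => [] [] // _ h1 h2; apply: (no b).
have := st M MT A AN n => /card_le_setT[h hI].
apply: cantor; exists (fun f => h (exist _ (p f) (mem_set (pc f)))) => f g /hI[/pI].
by [].
Qed.
End OmegaStable.

Lemma succ_card_gt Tau Kappa : succ_card Tau Kappa -> ~ injects Kappa Tau.
Proof. by move=> [[_ nle] _] h; apply: nle; apply/card_leTT. Qed.

Lemma almost_indiscernible_stable (L : language) (T : theory L) (Tau Mu Kappa : Type) :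
  complete T -> T #= [set: Tau] -> [set: Mu] #<= [set: Tau] -> succ_card Tau Kappa ->
  almost_indiscernible T Mu Kappa ->
  forall Lambda : Type, [set: Tau] #<= [set: Lambda] -> stable_in T Lambda.
Proof.
move=> Tc; rewrite card_eq_le => /andP[/card_le_setT TT _] /card_leTT muT.
move=> /succ_card_gt KT [M [MT Msat]].
rewrite card_eq_le => /andP[_ /card_leTT KM] [sigma [I [Iindisc Iacl]]].
have Tinf : infinite Tau := injects_trans (complete_infinite Tc) TT.
have fT := injects_trans (complete_fsym Tc) TT.
have rT := injects_trans (complete_rsym Tc) TT.
have Mbig : ~ injects M Tau by move=> h; apply: KT; exact: injects_trans KM h.
move=> Lambda /card_leTT TL N NT A /card_le_setT AL n; apply/card_le_setT.
apply: (injects_type_space Iindisc Tinf fT rT muT Mbig _ Iacl Tc MT _ NT TL AL).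
move=> B BT; apply: Msat; split; first exact: card_leT.
by move=> /card_le_injects h; apply: Mbig; apply: injects_trans (injects_to_setT M) _;
  exact: injects_trans h BT.
Qed.

Theorem theorem2p4 (L : language) (T : theory L) (T_complete : complete T) :
  (forall Tau Mu Kappa : Type,
     T #= [set: Tau] -> [set: Mu] #<= [set: Tau] -> succ_card Tau Kappa ->
     almost_indiscernible T Mu Kappa ->
     (forall Lambda : Type, [set: Tau] #<= [set: Lambda] -> stable_in T Lambda)
     /\ superstable T) /\
  (forall Aleph1 : Type,
     countable T -> succ_card nat Aleph1 -> almost_indiscernible T nat Aleph1 ->
     totally_transcendental T).
Proof.
split=> [Tau Mu Kappa TT muT TK ai|Aleph1 Tcount succ ai].
  have st := almost_indiscernible_stable T_complete TT muT TK ai.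
  by split=> //; exists Tau.
have TN : T #= [set: nat].
  apply: eq_card_nat => //; apply/infiniteP/card_le_injects.
  exact: injects_trans (injects_setT nat) (complete_infinite T_complete).
have st := almost_indiscernible_stable T_complete TN (card_lexx _) succ ai (card_lexx _).
by move=> M MT _ n phi; exact: ranked_of_stable st phi.
Qed.
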